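(* Let $\alpha=(s,u,t,v,\lambda,\varepsilon)$ with $s,u,t,v\in\mathbb C^\times$, $\lambda,\varepsilon\in\mathbb R$, and $x,y\in\mathbb C^\times$. The overlap coefficient $\Phi(x,y)=\Phi_\alpha(x,y)$ satisfies (whenever the occurring values of $\Phi$ and of the coefficients are defined) $$(\mu_y-\mu_t)\Phi(x,y)=\mathcal A(x)\Phi(q^2x,y)+\mathcal B(x)\Phi(x,y)+\mathcal A(x^{-1})\Phi(x/q^2,y),$$ $$(\mu_x-\mu_s)\Phi(x,y)=\mathcal A^\vartheta(y)\Phi(x,q^2y)+\mathcal B^\vartheta(y)\Phi(x,y)+\mathcal A^\vartheta(y^{-1})\Phi(x,y/q^2).$$
   Context: Fix $q\in(0,1)$. $(x;q)_\infty=\prod_{k\ge0}(1-xq^k)$, $\theta(x;q)=(x;q)_\infty(q/x;q)_\infty$; several arguments mean products, and $\pm$ in exponents means the product over all sign choices. $\mu_s=(s+s^{-1})/(q^{-1}-q)$. For $\alpha=(s,u,t,v,\lambda,\varepsilon)$ let $\alpha^\vartheta=(t,v,s,u,\lambda,-\varepsilon)$ and $\bar\alpha=(\bar s,\bar u,\bar t,\bar v,\lambda,\varepsilon)$; for a function $f=f_\alpha$ depending on $\alpha$, $f^\vartheta=f_{\alpha^\vartheta}$. Define $$f_{x,\alpha}(z)=\frac{(sq^{1-2i\lambda}x^{\pm1},uszq^{1+i\lambda};q^2)_\infty\,\theta(q^{2\varepsilon-i\lambda}uz/s;q^2)}{(uzq^{-i\lambda}x^{\pm1},sq^{1-i\lambda}/uz;q^2)_\infty}.$$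 Let $\langle f,g\rangle=\frac1{2\pi i}\int_{\mathbb T}f(z)\overline{g(\bar z^{-1})}\frac{dz}z$, with $\mathbb T$ the positively oriented unit circle. For $0<|ux|,|u/x|,|vy|,|v/y|\le q^2$ and $0<|s/u|,|t/v|\le q$, the overlap coefficient is $\Phi_\alpha(x,y)=\langle f_{x,\alpha},g\rangle$ with $g(z)=f_{\bar y,\bar\alpha^\vartheta}(1/z)$. Explicitly, $$\Phi_\alpha(x,y)=(sq^{1-2i\lambda}x^{\pm1},tq^{1+2i\lambda}y^{\pm1};q^2)_\infty\frac1{2\pi i}\int_{\mathcal C}\frac{(uszq^{1+i\lambda},tvzq^{1-i\lambda};q^2)_\infty\,\theta(uzq^{2\varepsilon-i\lambda}/s,vzq^{-2\varepsilon+i\lambda}/t;q^2)}{(uzq^{-i\lambda}x^{\pm1},sq^{1-i\lambda}/uz,vzq^{i\lambda}y^{\pm1},tq^{1+i\lambda}/vz;q^2)_\infty}\frac{dz}z$$ with $\mathcal C=\mathbb T$. For other values of the parameters $\Phi_\alpha(x,y)$ is defined by the same formula, with $\mathcal C$ a deformation of $\mathbb T$ having the points $u^{-1}sq^{1-i\lambda}q^{2k}$, $v^{-1}tq^{1+i\lambda}q^{2k}$ ($k\in\mathbb Z_{\ge0}$) inside and $u^{-1}q^{i\lambda}x^{\pm1}q^{-2k}$, $v^{-1}q^{-i\lambda}y^{\pm1}q^{-2k}$ outside (when such $\mathcal C$ exists). Put $(a,b,c,d)=(sq^{1-2i\lambda},sq^{1+2i\lambda},vtq/u,vq/ut)$,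 so that $d^\vartheta=uq/vs$. Then $\mathcal A=\mathcal A_\alpha$, $\mathcal B=\mathcal B_\alpha$ are $$\mathcal A(x)=\frac1{q^{-1}-q}\,\frac{(1-ax)(1-bx)(1-cx)(1-dx)}{(q^2/d^\vartheta)(1-x^2)(1-q^2x^2)},\qquad \mathcal B(x)=\frac{q^2/d^\vartheta+d^\vartheta/q^2}{q^{-1}-q}-\mu_t-\mathcal A(x)-\mathcal A(x^{-1}),$$ and $\mathcal A^\vartheta=\mathcal A_{\alpha^\vartheta}$, $\mathcal B^\vartheta=\mathcal B_{\alpha^\vartheta}$ (all parameters replaced according to $\alpha\mapsto\alpha^\vartheta$, so $d^\vartheta$ becomes $d$ and $\mu_t$ becomes $\mu_s$). *)

(* Defs.v *)
From Stdlib Require Import Reals List.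
From Coquelicot Require Export Coquelicot.
Open Scope C_scope.

(** [q ^ w] for a real base [q > 0] and a complex exponent [w]. *)
Definition qpow (q : R) (w : C) : C :=
  RtoC (Rpower q (Re w)) * (cos (Im w * ln q), sin (Im w * ln q))%R.

Fixpoint qpoch_fin (x : C) (p : R) (n : nat) : C :=
  match n with
  | O => 1
  | S m => qpoch_fin x p m * (1 - x * RtoC p ^ m)
  end.

(** [(x; p)_oo], the limit of the finite products (it exists when
    [Rabs p < 1]), taken on real and imaginary parts. *)
Definition qpoch (x : C) (p : R) : C :=
  (real (Lim_seq (fun n => Re (qpoch_fin x p n))),
   real (Lim_seq (fun n => Im (qpoch_fin x p n)))).

(** [(a x^{+1}, a x^{-1}; p)_oo], written with [x^{\pm 1}] on paper. *)
Definition qpoch_pm (a x : C) (p : R) : C := qpoch (a * x) p * qpoch (a / x) p.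

Definition qtheta (x : C) (p : R) : C := qpoch x p * qpoch (RtoC p / x) p.

Definition mu (q : R) (s : C) : C := (s + / s) / RtoC (/ q - q).

Record params : Set := Params {
  ps : C; pu : C; pt : C; pv : C; plam : R; peps : R }.

Definition vartheta (al : params) : params :=
  Params (pt al) (pv al) (ps al) (pu al) (plam al) (- peps al).

Definition conj_params (al : params) : params :=
  Params (Cconj (ps al)) (Cconj (pu al)) (Cconj (pt al)) (Cconj (pv al))
    (plam al) (peps al).

(** C^1 paths, parametrized by [0, 1].  Only the restriction to [0, 1] matters;
    a path that is C^1 on [0, 1] with one-sided derivatives at the endpoints
    extends to such a function on the whole line. *)
Record path := Path {
  pos :> R -> C;
  vel : R -> C;
  pos_derive : forall r : R,
    is_derive (K := R_AbsRing) (V := C_R_NormedModule) pos r (vel r);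
  vel_continuous : forall r : R,
    continuous (T := R_UniformSpace) (U := C_UniformSpace) vel r }.

(** A piecewise C^1 curve is a list of C^1 paths; [chain z g w] says that they
    are joined end to end and lead from [z] to [w]. *)
Fixpoint chain (z : C) (g : list path) (w : C) : Prop :=
  match g with
  | nil => z = w
  | p :: g' => p 0%R = z /\ chain (p 1%R) g' w
  end.

Definition closed_curve (g : list path) : Prop := exists z : C, chain z g z.

Definition path_integral (f : C -> C) (p : path) : C :=
  RInt (V := C_R_CompleteNormedModule) (fun r : R => f (p r) * vel p r) 0 1.

Definition contour_integral (f : C -> C) (g : list path) : C :=
  fold_right Cplus 0 (map (path_integral f) g).

Definition avoids (g : list path) (z : C) : Prop :=
  forall p, In p g -> forall r : R, (0 <= r <= 1)%R -> p r <> z.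

Definition winding (g : list path) (z : C) : C :=
  / (2 * PI * Ci) * contour_integral (fun w => / (w - z)) g.

(** A point not on the curve is inside (outside) when the curve winds around it
    once in the positive direction (zero times). *)
Definition inside (g : list path) (z : C) : Prop := avoids g z /\ winding g z = 1.
Definition outside (g : list path) (z : C) : Prop := avoids g z /\ winding g z = 0.

(** A closed curve in the punctured plane is a deformation (there) of the
    positively oriented unit circle iff 0 is [inside] it. *)
Definition admissible (q : R) (al : params) (x y : C) (g : list path) : Prop :=
  let s := ps al in let u := pu al in let t := pt al in let v := pv al in
  let il := Ci * plam al in
  closed_curve g /\ inside g 0 /\
  forall k : nat,
    let Q := RtoC (q ^ 2) ^ k in
    inside g (s / u * qpow q (1 - il) * Q) /\
    inside g (t / v * qpow q (1 + il) * Q) /\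
    outside g (/ u * qpow q il * x / Q) /\
    outside g (/ u * qpow q il / x / Q) /\
    outside g (/ v * qpow q (- il) * y / Q) /\
    outside g (/ v * qpow q (- il) / y / Q).

Definition overlap_prefactor (q : R) (al : params) (x y : C) : C :=
  let il := Ci * plam al in
  qpoch_pm (ps al * qpow q (1 - 2 * il)) x (q ^ 2) *
  qpoch_pm (pt al * qpow q (1 + 2 * il)) y (q ^ 2).

Definition overlap_kernel (q : R) (al : params) (x y z : C) : C :=
  let s := ps al in let u := pu al in let t := pt al in let v := pv al in
  let il := Ci * plam al in let e := RtoC (peps al) in
  (qpoch (u * s * z * qpow q (1 + il)) (q ^ 2) *
   qpoch (t * v * z * qpow q (1 - il)) (q ^ 2) *
   qtheta (u * z * qpow q (2 * e - il) / s) (q ^ 2) *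
   qtheta (v * z * qpow q (- 2 * e + il) / t) (q ^ 2)) /
  (qpoch_pm (u * z * qpow q (- il)) x (q ^ 2) *
   qpoch (s * qpow q (1 - il) / (u * z)) (q ^ 2) *
   qpoch_pm (v * z * qpow q il) y (q ^ 2) *
   qpoch (t * qpow q (1 + il) / (v * z)) (q ^ 2)).

(** [is_overlap q al x y w]: the overlap coefficient [Phi_al(x,y)] is defined
    and has the value [w]. *)
Definition is_overlap (q : R) (al : params) (x y w : C) : Prop :=
  exists g : list path, admissible q al x y g /\
    w = overlap_prefactor q al x y *
        (/ (2 * PI * Ci) *
         contour_integral (fun z => overlap_kernel q al x y z / z) g).

Definition f_fun (q : R) (al : params) (x z : C) : C :=
  let s := ps al in let u := pu al in
  let il := Ci * plam al in let e := RtoC (peps al) in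
  (qpoch_pm (s * qpow q (1 - 2 * il)) x (q ^ 2) *
   qpoch (u * s * z * qpow q (1 + il)) (q ^ 2) *
   qtheta (qpow q (2 * e - il) * u * z / s) (q ^ 2)) /
  (qpoch_pm (u * z * qpow q (- il)) x (q ^ 2) *
   qpoch (s * qpow q (1 - il) / (u * z)) (q ^ 2)).

Definition g_fun (q : R) (al : params) (y z : C) : C :=
  f_fun q (conj_params (vartheta al)) (Cconj y) (/ z).

Lemma Cinv_conj' (a : C) : Cconj (/ a) = / Cconj a.
Proof.
destruct a as [a b]; unfold Cconj, Cinv; simpl.
replace (- b * (- b * 1))%R with (b * (b * 1))%R by ring.
f_equal; unfold Rdiv; ring.
Qed.

Lemma Cinv_mult' (a b : C) : / (a * b) = / a * / b.
Proof.
destruct (Ceq_dec a 0) as [->|ha].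
  replace (0 * b) with (RtoC 0) by ring.
  replace (/ RtoC 0) with (RtoC 0) by
    (unfold Cinv, RtoC; simpl; f_equal; unfold Rdiv; ring).
  ring.
destruct (Ceq_dec b 0) as [->|hb].
  replace (a * 0) with (RtoC 0) by ring.
  replace (/ RtoC 0) with (RtoC 0) by
    (unfold Cinv, RtoC; simpl; f_equal; unfold Rdiv; ring).
  ring.
now field.
Qed.

Lemma Cinv_inv' (a : C) : / / a = a.
Proof.
destruct (Ceq_dec a 0) as [->|ha].
  replace (/ RtoC 0) with (RtoC 0) by
    (unfold Cinv, RtoC; simpl; f_equal; unfold Rdiv; ring).
  unfold Cinv, RtoC; simpl; f_equal; unfold Rdiv; ring.
now field.
Qed.

Lemma Cdiv_conj' (a b : C) : Cconj (a / b) = Cconj a / Cconj b.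
Proof. now unfold Cdiv; rewrite Cmult_conj, Cinv_conj'. Qed.

Lemma RtoC_conj (r : R) : Cconj (RtoC r) = RtoC r.
Proof. unfold Cconj, RtoC; simpl; f_equal; ring. Qed.

Lemma Ci_conj : Cconj Ci = - Ci.
Proof. unfold Cconj, Ci, Copp; simpl; f_equal; ring. Qed.

Lemma qpow_conj (q : R) (w : C) : Cconj (qpow q w) = qpow q (Cconj w).
Proof.
unfold qpow; rewrite Cmult_conj, RtoC_conj, re_conj, im_conj.
f_equal; unfold Cconj; simpl.
rewrite Ropp_mult_distr_l_reverse, cos_neg, sin_neg; reflexivity.
Qed.

Lemma qpoch_fin_conj (x : C) (p : R) (n : nat) :
  Cconj (qpoch_fin x p n) = qpoch_fin (Cconj x) p n.
Proof.
induction n as [|n IH]; simpl; [apply RtoC_conj|].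
now rewrite Cmult_conj, IH, Cminus_conj, Cmult_conj, Cpow_conj, !RtoC_conj.
Qed.

Lemma qpoch_conj (x : C) (p : R) : Cconj (qpoch x p) = qpoch (Cconj x) p.
Proof.
unfold qpoch, Cconj at 1; simpl; f_equal.
  apply f_equal, Lim_seq_ext; intros n.
  now rewrite <- qpoch_fin_conj, re_conj.
rewrite (Lim_seq_ext (fun n => Im (qpoch_fin (Cconj x) p n))
           (fun n => (- Im (qpoch_fin x p n))%R)).
  now rewrite Lim_seq_opp; destruct (Lim_seq _); simpl; try ring.
intros n; now rewrite <- qpoch_fin_conj, im_conj.
Qed.

Lemma f_fun_conj (q : R) (al : params) (x z : C) :
  Cconj (f_fun q (conj_params al) (Cconj x) (Cconj z)) =
  let s := ps al in let u := pu al in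
  let il := Ci * plam al in let e := RtoC (peps al) in
  (qpoch_pm (s * qpow q (1 + 2 * il)) x (q ^ 2) *
   qpoch (u * s * z * qpow q (1 - il)) (q ^ 2) *
   qtheta (qpow q (2 * e + il) * u * z / s) (q ^ 2)) /
  (qpoch_pm (u * z * qpow q il) x (q ^ 2) *
   qpoch (s * qpow q (1 + il) / (u * z)) (q ^ 2)).
Proof.
destruct al as [s u t v l e]; unfold f_fun, qpoch_pm, qtheta; simpl.
repeat (rewrite ?Cdiv_conj', ?Cmult_conj, ?qpoch_conj, ?qpow_conj, ?Cminus_conj,
  ?Cplus_conj, ?Copp_conj, ?Ci_conj, ?RtoC_conj, ?Cconj_conj).
replace (1 - 2 * (- Ci * l)) with (1 + 2 * (Ci * l)) by ring.
replace (1 + - Ci * l) with (1 - Ci * l) by ring.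
replace (2 * e - - Ci * l) with (2 * e + Ci * l) by ring.
replace (- (- Ci * l)) with (Ci * l) by ring.
replace (1 - - Ci * l) with (1 + Ci * l) by ring.
reflexivity.
Qed.

(** The integrand defining [is_overlap] is that of the inner product
    [<f_x, g> = 1/(2 pi i) \int f_x(z) \bar{g(1/\bar z)} dz/z]. *)
Lemma overlap_integrandE (q : R) (al : params) (x y z : C) :
  f_fun q al x z * Cconj (g_fun q al y (/ Cconj z)) =
  overlap_prefactor q al x y * overlap_kernel q al x y z.
Proof.
unfold g_fun; rewrite Cinv_inv', f_fun_conj.
destruct al as [s u t v l e].
unfold f_fun, overlap_prefactor, overlap_kernel, vartheta; simpl.
rewrite RtoC_opp.
replace (2 * - e + Ci * l) with (- 2 * e + Ci * l) by ring.
replace (qpow q (2 * e - Ci * l) * u * z) with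
  (u * z * qpow q (2 * e - Ci * l)) by ring.
replace (qpow q (- 2 * e + Ci * l) * v * z) with
  (v * z * qpow q (- 2 * e + Ci * l)) by ring.
replace (v * t * z) with (t * v * z) by ring.
unfold Cdiv; rewrite !Cinv_mult'; ring.
Qed.

(** The parameter [d^vartheta], i.e. [d = vq/(ut)] at [vartheta al]. *)
Definition coef_dt (q : R) (al : params) : C := pu al * q / (pv al * ps al).

Definition coef_A (q : R) (al : params) (x : C) : C :=
  let s := ps al in let u := pu al in let t := pt al in let v := pv al in
  let il := Ci * plam al in
  let a := s * qpow q (1 - 2 * il) in
  let b := s * qpow q (1 + 2 * il) in
  let c := v * t * q / u in
  let d := v * q / (u * t) in
  / RtoC (/ q - q) *
  (((1 - a * x) * (1 - b * x) * (1 - c * x) * (1 - d * x)) /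
   (RtoC (q ^ 2) / coef_dt q al * (1 - x ^ 2) * (1 - RtoC (q ^ 2) * x ^ 2))).

(** For nonzero parameters and argument, the condition that [coef_A q al x] has
    nonzero denominator. *)
Definition coef_A_defined (q : R) (x : C) : Prop :=
  1 - x ^ 2 <> 0 /\ 1 - RtoC (q ^ 2) * x ^ 2 <> 0.

Definition coef_B (q : R) (al : params) (x : C) : C :=
  let dt := coef_dt q al in
  (RtoC (q ^ 2) / dt + dt / RtoC (q ^ 2)) / RtoC (/ q - q) - mu q (pt al)
  - coef_A q al x - coef_A q al (/ x).

(* Main.v *)
Require Import Defs.
From Stdlib Require Import Reals Lra Lia List Arith.Wf_nat.
From Stdlib Require Import Classical IndefiniteDescription.
From Coquelicot Require Import Coquelicot.
Open Scope C_scope.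

(** Both recurrences come from one pointwise identity for the integrand.  Write
    K(x; z) for the integrand without its prefactor.  For fixed z the combination
    of K(q^2 x; z), K(x; z) and K(x/q^2; z) prescribed by the recurrence in x is a
    total q^2-difference, a multiple of z (G(z) - q^2 G(q^2 z)), where G (the
    [potential]) is again a quotient of products of q-shifted factorials.  This is
    [kernel_relation]; after the common infinite products are divided out it is the
    rational identity [askey_wilson_identity].  Integrating dz/z over a contour C
    turns the right-hand side into the difference of the integrals of G over C and
    over the dilated contour q^2 C.  In G the factors vanishing at the first point
    of each inner progression of poles have cancelled, so no pole of G lies between
    C and q^2 C and the difference is 0.  The recurrence in y is the recurrence in x
    for the parameters (t, v, s, u, -lambda, -epsilon), with x and y exchanged:
    this exchange leaves the integrand unchanged, and the coefficients do not
    depend on the sign of lambda.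

    The three values of the overlap coefficient are computed with three unrelated
    contours, and a contour that is good for one of them may wind about a pole of
    another, or run through it.  Two facts reconcile them.

    First, [cauchy_homology]: the integral over a sum of closed curves depends only
    on the winding numbers about the poles.  Truncating every infinite product gives
    rational functions whose poles are 0 and poles of the limit, and which converge
    locally uniformly off these points; for a rational function, partial fractions
    reduce the claim to 1/(z - c) and to functions with a primitive.

    Second, [contour_exists]: when inner and outer poles are distinct, some sum of
    circles winds once about 0 and about every inner pole and not at all about the
    outer ones.  Applied to all poles occurring for x, q^2 x and x/q^2 it gives a
    contour on which the identity can be integrated; the distinctness is forced by
    the existence of the three given contours. *)

(** * Limits of complex-valued functions *)

(** Convergence is expressed with the modulus, which makes estimates for products
    and inverses direct; [tendsto_filterlim] translates it into the product
    uniform structure of the plane. *)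
Definition tendsto {T : Type} (F : (T -> Prop) -> Prop) (f : T -> C) (l : C) :=
  forall e : R, (0 < e)%R -> F (fun t => (Cmod (f t - l) < e)%R).

Lemma tendsto_const {T} F {FF : Filter F} (c : C) :
  tendsto F (fun _ : T => c) c.
Proof.
intros e he; apply filter_forall; intros _.
replace (c - c) with (RtoC 0) by ring; now rewrite Cmod_0.
Qed.

Lemma tendsto_ext {T} F {FF : Filter F} (f g : T -> C) (l : C) :
  F (fun t => f t = g t) -> tendsto F f l -> tendsto F g l.
Proof.
intros hfg hf e he; generalize (filter_and _ _ hfg (hf e he)).
apply filter_imp; now intros t [<- h].
Qed.

Lemma tendsto_plus {T} F {FF : Filter F} (f g : T -> C) (l m : C) :
  tendsto F f l -> tendsto F g m -> tendsto F (fun t => f t + g t) (l + m).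
Proof.
intros hf hg e he; assert (he2 : (0 < e / 2)%R) by lra.
generalize (filter_and _ _ (hf _ he2) (hg _ he2)); apply filter_imp.
intros t [h1 h2]; replace (f t + g t - (l + m)) with ((f t - l) + (g t - m)) by ring.
eapply Rle_lt_trans; [apply Cmod_triangle|lra].
Qed.

Lemma tendsto_mult {T} F {FF : Filter F} (f g : T -> C) (l m : C) :
  tendsto F f l -> tendsto F g m -> tendsto F (fun t => f t * g t) (l * m).
Proof.
intros hf hg e he.
pose proof (Cmod_ge_0 l) as hl; pose proof (Cmod_ge_0 m) as hm.
set (d := Rmin 1 (e / (Cmod l + Cmod m + 2))).
assert (hd : (0 < d)%R).
  apply Rmin_glb_lt; [lra|apply Rdiv_lt_0_compat; lra].
generalize (filter_and _ _ (hf _ hd) (hg _ hd)); apply filter_imp.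
intros t [h1 h2].
replace (f t * g t - l * m)
  with ((f t - l) * (g t - m) + ((f t - l) * m + l * (g t - m))) by ring.
assert (hde : (d * (Cmod l + Cmod m + 2) <= e)%R).
  apply Rle_trans with (e / (Cmod l + Cmod m + 2) * (Cmod l + Cmod m + 2))%R.
    apply Rmult_le_compat_r; [lra|apply Rmin_r].
  right; field; lra.
assert (hd1 : (d <= 1)%R) by apply Rmin_l.
pose proof (Cmod_ge_0 (f t - l)) as h3; pose proof (Cmod_ge_0 (g t - m)) as h4.
eapply Rle_lt_trans; [apply Cmod_triangle|].
eapply Rle_lt_trans; [apply Rplus_le_compat_l, Cmod_triangle|].
rewrite !Cmod_mult; nra.
Qed.

Lemma tendsto_inv {T} F {FF : Filter F} (f : T -> C) (l : C) :
  l <> 0 -> tendsto F f l -> tendsto F (fun t => / f t) (/ l).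
Proof.
intros hl0 hf e he.
assert (hl : (0 < Cmod l)%R) by exact (proj1 (Cmod_gt_0 l) hl0).
set (d := Rmin (Cmod l / 2) (e * (Cmod l * Cmod l) / 2)).
assert (hd : (0 < d)%R).
  apply Rmin_glb_lt; [lra|].
  apply Rdiv_lt_0_compat; [|lra]; repeat apply Rmult_lt_0_compat; lra.
generalize (hf _ hd); apply filter_imp; intros t h1.
assert (h2 : (Cmod l / 2 <= Cmod (f t))%R).
  assert (Cmod l <= Cmod (f t) + Cmod (f t - l))%R.
    replace l with (f t + - (f t - l)) at 1 by ring.
    eapply Rle_trans; [apply Cmod_triangle|]; rewrite Cmod_opp; lra.
  assert (d <= Cmod l / 2)%R by apply Rmin_l; lra.
assert (hft : f t <> 0).
  intros h; rewrite h, Cmod_0 in h2; lra.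
replace (/ f t - / l) with (- (f t - l) * / (f t * l)) by now field.
rewrite Cmod_mult, Cmod_opp, Cmod_inv, Cmod_mult by (now apply Cmult_neq_0).
assert (hd2 : (d <= e * (Cmod l * Cmod l) / 2)%R) by apply Rmin_r.
assert (h3 : (0 < Cmod (f t) * Cmod l)%R) by (apply Rmult_lt_0_compat; lra).
apply Rmult_lt_reg_r with (1 := h3).
rewrite Rmult_assoc, Rinv_l, Rmult_1_r by lra.
apply Rlt_le_trans with (1 := h1), Rle_trans with (1 := hd2).
replace (e * (Cmod l * Cmod l) / 2)%R with (e * (Cmod l / 2 * Cmod l))%R by field.
apply Rmult_le_compat_l; [lra|]; apply Rmult_le_compat_r; lra.
Qed.

Lemma tendsto_comp {S T} (F : (S -> Prop) -> Prop) (G : (T -> Prop) -> Prop)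
    (h : S -> T) (f : T -> C) (l : C) :
  filterlim h F G -> tendsto G f l -> tendsto F (fun s => f (h s)) l.
Proof. intros hh hf e he; exact (hh _ (hf e he)). Qed.

Lemma tendsto_filterlim {T} F {FF : Filter F} (f : T -> C) (l : C) :
  tendsto F f l <->
  filterlim f F (locally (T := C_UniformSpace) l).
Proof.
split; intros h.
- apply (proj2 (filterlim_locally_ball_norm (U := C_R_NormedModule) f l)).
  intros e; generalize (h e (cond_pos e)); apply filter_imp.
  intros t ht; unfold ball_norm; rewrite <- Cmod_norm; exact ht.
- intros e he.
  generalize (proj1 (filterlim_locally_ball_norm (U := C_R_NormedModule) f l) h
    (mkposreal e he)); apply filter_imp.
  intros t ht; unfold ball_norm in ht; rewrite <- Cmod_norm in ht; exact ht.
Qed.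

Lemma tendsto_id (z : C) :
  tendsto (locally (T := C_UniformSpace) z) (fun w => w) z.
Proof. apply (tendsto_filterlim _); apply filterlim_id. Qed.

(** A sequence of functions is made to converge along n -> oo and w -> z together.
    This continuous convergence is stable under the same algebraic operations as
    pointwise limits, and on compact sets it amounts to uniform convergence. *)
Definition joint (z : C) : (nat * C -> Prop) -> Prop :=
  filter_prod eventually (locally (T := C_UniformSpace) z).

#[global] Instance joint_filter z : ProperFilter (joint z).
Proof. unfold joint; typeclasses eauto. Qed.

Definition cconv (fn : nat -> C -> C) (z l : C) : Prop :=
  tendsto (joint z) (fun nz => fn (fst nz) (snd nz)) l.

Lemma cconv_snd (h : C -> C) (z l : C) :
  tendsto (locally (T := C_UniformSpace) z) h l -> cconv (fun _ => h) z l.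
Proof.
intros hh; apply (tendsto_comp _ _ (fun nz : nat * C => snd nz) h l) with (2 := hh).
apply filterlim_snd.
Qed.

Lemma cconv_comp (fn : nat -> C -> C) (h : C -> C) (z l : C) :
  tendsto (locally (T := C_UniformSpace) z) h (h z) ->
  cconv fn (h z) l -> cconv (fun n w => fn n (h w)) z l.
Proof.
intros hh hf.
apply (tendsto_comp _ (joint (h z)) (fun nz : nat * C => (fst nz, h (snd nz)))
  (fun nz => fn (fst nz) (snd nz)) l) with (2 := hf).
apply (filterlim_pair (fun nz : nat * C => fst nz) (fun nz : nat * C => h (snd nz))).
  apply filterlim_fst.
apply filterlim_comp with (2 := proj1 (tendsto_filterlim _ _ _) hh).
apply filterlim_snd.
Qed.

Lemma cconv_pointwise fn (z l : C) :
  cconv fn z l -> tendsto eventually (fun n => fn n z) l.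
Proof.
intros h; apply (tendsto_comp eventually (joint z) (fun n => (n, z))
  (fun nz => fn (fst nz) (snd nz)) l) with (2 := h).
apply filterlim_pair; [apply filterlim_id|].
intros P hP; exists O; intros n _; exact (locally_singleton _ _ hP).
Qed.
(** * Infinite q-shifted factorials *)

Lemma Rpow_small (p : R) (hp : (0 < p < 1)%R) (M e : R) :
  (0 < e)%R -> exists N : nat, forall n, (N <= n)%nat -> (M * p ^ n < e)%R.
Proof.
intros he.
assert (hp' : (Rabs p < 1)%R) by (rewrite Rabs_right; lra).
assert (hM : (0 < Rmax M 1)%R) by (apply Rlt_le_trans with 1%R; [lra|apply Rmax_r]).
destruct (pow_lt_1_zero p hp' (e / Rmax M 1)) as [N hN].
  now apply Rdiv_lt_0_compat.
exists N; intros n hn; specialize (hN n hn).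
assert (h0 : (0 < p ^ n)%R) by (apply pow_lt; lra).
rewrite Rabs_right in hN by lra.
apply Rle_lt_trans with (Rmax M 1 * p ^ n)%R.
  apply Rmult_le_compat_r; [lra|apply Rmax_l].
apply Rmult_lt_reg_r with (/ Rmax M 1)%R; [now apply Rinv_0_lt_compat|].
replace (Rmax M 1 * p ^ n * / Rmax M 1)%R with (p ^ n)%R by (field; lra).
exact hN.
Qed.

Lemma Cdiv_neq_0 (a b : C) : a <> 0 -> b <> 0 -> a / b <> 0.
Proof.
intros ha hb h; apply ha; replace a with (a / b * b) by (field; exact hb).
rewrite h; ring.
Qed.

Lemma Cinv_neq_0 (a : C) : a <> 0 -> / a <> 0.
Proof. intros ha; rewrite <- (Cmult_1_l (/ a)); apply Cdiv_neq_0; [exact C1_nz|exact ha]. Qed.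

Lemma RtoC_neq_0 (P : R) : (0 < P)%R -> RtoC P <> 0.
Proof. intros hP h; apply RtoC_inj in h; lra. Qed.

Lemma Cmod_RtoC_pow (p : R) (n : nat) : (0 < p)%R -> Cmod (RtoC p ^ n) = (p ^ n)%R.
Proof.
intros hp; rewrite <- RtoC_pow, Cmod_R; apply Rabs_right.
apply Rle_ge, pow_le; lra.
Qed.

Lemma qpoch_fin_shift (x : C) (p : R) (N n : nat) :
  qpoch_fin x p (N + n) = qpoch_fin x p N * qpoch_fin (x * RtoC p ^ N) p n.
Proof.
induction n as [|n IH]; [rewrite Nat.add_0_r; simpl; ring|].
rewrite Nat.add_succ_r; simpl; rewrite IH, Cpow_add_r; ring.
Qed.

Lemma tendsto_qpoch_fin (p : R) (n : nat) (z : C) :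
  tendsto (locally (T := C_UniformSpace) z) (fun w => qpoch_fin w p n) (qpoch_fin z p n).
Proof.
induction n as [|n IH]; simpl; [apply tendsto_const; typeclasses eauto|].
apply (tendsto_mult _ _ _ _ _ IH).
unfold Cminus; apply (tendsto_plus _ _ _ _ _ (tendsto_const _ _)).
apply (tendsto_ext _ (fun w => w * (- RtoC p ^ n))).
  apply filter_forall; intros w; ring.
replace (- (z * RtoC p ^ n)) with (z * (- RtoC p ^ n)) by ring.
apply (tendsto_mult _ _ _ _ _ (tendsto_id z) (tendsto_const _ _)).
Qed.

(** The bound (1 - p)/4 on the argument is chosen so that the errors, at most
    2 |x| p^k at the k-th factor, sum to at most (1 - p^n)/2. *)
Lemma qpoch_fin_near_1 (p : R) (hp : (0 < p < 1)%R) (x : C) :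
  (Cmod x <= (1 - p) / 4)%R ->
  forall n, (Cmod (qpoch_fin x p n - 1) <= (1 - p ^ n) / 2)%R.
Proof.
intros hx n; induction n as [|n IH]; simpl.
  replace (1 - 1) with (RtoC 0) by ring; rewrite Cmod_0; lra.
assert (h0 : (0 < p ^ n)%R) by (apply pow_lt; lra).
replace (qpoch_fin x p n * (1 - x * RtoC p ^ n) - 1)
  with ((qpoch_fin x p n - 1) * (1 - x * RtoC p ^ n) + - (x * RtoC p ^ n)) by ring.
assert (h1 : (Cmod (x * RtoC p ^ n) <= (1 - p) / 4 * p ^ n)%R).
  rewrite Cmod_mult, Cmod_RtoC_pow by lra; apply Rmult_le_compat_r; lra.
pose proof (Cmod_ge_0 (x * RtoC p ^ n)) as h1'.
assert (h2 : (Cmod (1 - x * RtoC p ^ n) <= 1 + Cmod (x * RtoC p ^ n))%R).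
  unfold Cminus; eapply Rle_trans; [apply Cmod_triangle|].
  rewrite Cmod_opp, Cmod_1; lra.
eapply Rle_trans; [apply Cmod_triangle|]; rewrite Cmod_opp, Cmod_mult.
pose proof (Cmod_ge_0 (qpoch_fin x p n - 1)) as h3.
pose proof (Cmod_ge_0 (1 - x * RtoC p ^ n)) as h4.
assert (h5 : (Cmod (qpoch_fin x p n - 1) * Cmod (1 - x * RtoC p ^ n) <=
  Cmod (qpoch_fin x p n - 1) * 1 + 1 / 2 * Cmod (x * RtoC p ^ n))%R) by nra.
nra.
Qed.

(** The tail of a product is again such a product, with argument x p^n; hence a
    geometric rate that is uniform in x. *)
Lemma qpoch_fin_cauchy (p : R) (hp : (0 < p < 1)%R) (x : C) :
  (Cmod x <= (1 - p) / 4)%R ->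
  forall n k, (Cmod (qpoch_fin x p (n + k) - qpoch_fin x p n) <= p ^ n)%R.
Proof.
intros hx n k; rewrite qpoch_fin_shift.
assert (h0 : (0 < p ^ n)%R) by (apply pow_lt; lra).
assert (hb : forall m, (Cmod (qpoch_fin x p m) <= 2)%R).
  intros m; replace (qpoch_fin x p m) with (qpoch_fin x p m - 1 + 1) by ring.
  eapply Rle_trans; [apply Cmod_triangle|]; rewrite Cmod_1.
  pose proof (qpoch_fin_near_1 p hp x hx m).
  assert (0 < p ^ m)%R by (apply pow_lt; lra); lra.
assert (hk : forall k, (Cmod (qpoch_fin (x * RtoC p ^ n) p k - 1) <= p ^ n * (1 - p ^ k) / 2)%R).
  clear k; intros k; induction k as [|k IH]; simpl.
    replace (1 - 1) with (RtoC 0) by ring; rewrite Cmod_0; lra.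
  assert (hk0 : (0 < p ^ k)%R) by (apply pow_lt; lra).
  assert (hpn : (p ^ n <= 1)%R).
    rewrite <- (pow1 n); apply pow_incr; lra.
  assert (hpk : (p ^ k <= 1)%R).
    rewrite <- (pow1 k); apply pow_incr; lra.
  set (y := x * RtoC p ^ n) in *.
  assert (hy : (Cmod (y * RtoC p ^ k) <= (1 - p) / 4 * p ^ n * p ^ k)%R).
    unfold y; rewrite !Cmod_mult, !Cmod_RtoC_pow by lra.
    repeat (apply Rmult_le_compat_r; [lra|]); lra.
  replace (qpoch_fin y p k * (1 - y * RtoC p ^ k) - 1)
    with ((qpoch_fin y p k - 1) + - (qpoch_fin y p k * (y * RtoC p ^ k))) by ring.
  eapply Rle_trans; [apply Cmod_triangle|]; rewrite Cmod_opp, Cmod_mult.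
  assert (hc : (Cmod (qpoch_fin y p k) <= 2)%R).
    replace (qpoch_fin y p k) with (qpoch_fin y p k - 1 + 1) by ring.
    eapply Rle_trans; [apply Cmod_triangle|]; rewrite Cmod_1; nra.
  pose proof (Cmod_ge_0 (qpoch_fin y p k)); pose proof (Cmod_ge_0 (y * RtoC p ^ k)).
  apply Rle_trans with (p ^ n * (1 - p ^ k) / 2 + 2 * ((1 - p) / 4 * p ^ n * p ^ k))%R.
    apply Rplus_le_compat; [exact IH|apply Rmult_le_compat; lra].
  right; field.
replace (qpoch_fin x p n * qpoch_fin (x * RtoC p ^ n) p k - qpoch_fin x p n)
  with (qpoch_fin x p n * (qpoch_fin (x * RtoC p ^ n) p k - 1)) by ring.
rewrite Cmod_mult.
apply Rle_trans with (2 * (p ^ n * (1 - p ^ k) / 2))%R.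
  apply Rmult_le_compat; auto using Cmod_ge_0.
assert (0 < p ^ k)%R by (apply pow_lt; lra); nra.
Qed.

Lemma Im_le_Cmod (z : C) : (Rabs (Im z) <= Cmod z)%R.
Proof. apply Rle_trans with (2 := Rmax_Cmod z), Rmax_r. Qed.

Lemma qpoch_lim (x l : C) (p : R) :
  tendsto eventually (fun n => qpoch_fin x p n) l -> qpoch x p = l.
Proof.
intros h; unfold qpoch.
rewrite (is_lim_seq_unique _ (Re l)), (is_lim_seq_unique _ (Im l)); [now destruct l| |].
- apply is_lim_seq_spec; intros e; generalize (h e (cond_pos e)).
  intros [N hN]; exists N; intros n hn; specialize (hN n hn).
  eapply Rle_lt_trans; [|exact hN].
  replace (Im (qpoch_fin x p n) - Im l)%R with (Im (qpoch_fin x p n - l)) by reflexivity.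
  apply Im_le_Cmod.
- apply is_lim_seq_spec; intros e; generalize (h e (cond_pos e)).
  intros [N hN]; exists N; intros n hn; specialize (hN n hn).
  eapply Rle_lt_trans; [|exact hN].
  replace (Re (qpoch_fin x p n) - Re l)%R with (Re (qpoch_fin x p n - l)) by reflexivity.
  apply re_le_Cmod.
Qed.

Lemma Ccauchy_lim (f : nat -> C) :
  (forall e : R, (0 < e)%R -> exists N, forall n m, (N <= n)%nat -> (N <= m)%nat ->
     (Cmod (f n - f m) < e)%R) ->
  exists l, tendsto eventually f l.
Proof.
intros h.
assert (hR : ex_finite_lim_seq (fun n => Re (f n))).
  apply ex_lim_seq_cauchy_corr; intros e; destruct (h e (cond_pos e)) as [N hN].
  exists N; intros n m hn hm; eapply Rle_lt_trans; [|exact (hN n m hn hm)].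
  exact (re_le_Cmod (f n - f m)).
assert (hI : ex_finite_lim_seq (fun n => Im (f n))).
  apply ex_lim_seq_cauchy_corr; intros e; destruct (h e (cond_pos e)) as [N hN].
  exists N; intros n m hn hm; eapply Rle_lt_trans; [|exact (hN n m hn hm)].
  exact (Im_le_Cmod (f n - f m)).
destruct hR as [a ha], hI as [b hb]; exists (a, b).
apply (proj2 (tendsto_filterlim _ f (a, b))).
apply (filterlim_ext (fun n => (Re (f n), Im (f n)))).
  now intros n; destruct (f n).
assert (hab : filterlim (fun n => (Re (f n), Im (f n))) eventually
    (filter_prod (locally a) (locally b))).
  now apply filterlim_pair.
intros P hP; apply hab; destruct hP as [e he].
exists (ball a e) (ball b e); [apply locally_ball|apply locally_ball|].
intros u w hu hw; apply he; split; assumption.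
Qed.

Lemma cconv_qpoch_small (p : R) (hp : (0 < p < 1)%R) (x : C) :
  (Cmod x < (1 - p) / 4)%R -> cconv (fun n z => qpoch_fin z p n) x (qpoch x p).
Proof.
intros hx.
destruct (Ccauchy_lim (fun n => qpoch_fin x p n)) as [l hl].
  intros e he; destruct (Rpow_small p hp 2 e he) as [N hN]; exists N.
  intros n m hn hm; specialize (hN N (le_n N)).
  replace n with (N + (n - N))%nat by lia; replace m with (N + (m - N))%nat by lia.
  replace (qpoch_fin x p (N + (n - N)) - qpoch_fin x p (N + (m - N))) with
    ((qpoch_fin x p (N + (n - N)) - qpoch_fin x p N) +
     - (qpoch_fin x p (N + (m - N)) - qpoch_fin x p N)) by ring.
  eapply Rle_lt_trans; [apply Cmod_triangle|]; rewrite Cmod_opp.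
  pose proof (qpoch_fin_cauchy p hp x (Rlt_le _ _ hx) N (n - N)).
  pose proof (qpoch_fin_cauchy p hp x (Rlt_le _ _ hx) N (m - N)); lra.
rewrite (qpoch_lim _ _ _ hl); intros e he.
destruct (Rpow_small p hp 1 (e / 4)) as [N hN]; [lra|].
destruct (hl (e / 4)%R) as [N' hN']; [lra|].
set (M := Nat.max N N').
assert (hN1 : (p ^ M < e / 4)%R).
  specialize (hN M (Nat.le_max_l _ _)); lra.
assert (hN2 := hN' M (Nat.le_max_r _ _)).
assert (h1 : locally (T := C_UniformSpace) x (fun z => (Cmod z <= (1 - p) / 4)%R)).
  assert (hd : (0 < (1 - p) / 4 - Cmod x)%R) by lra.
  generalize (tendsto_id x _ hd); apply filter_imp; intros z hz.
  replace z with (z - x + x) by ring.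
  eapply Rle_trans; [apply Cmod_triangle|lra].
assert (h2 := tendsto_qpoch_fin p M x (e / 4)%R ltac:(lra)).
exists (fun n => (M <= n)%nat) (fun z => (Cmod z <= (1 - p) / 4)%R /\
   (Cmod (qpoch_fin z p M - qpoch_fin x p M) < e / 4)%R).
- now exists M.
- now apply filter_and.
- intros n z hn [hz1 hz2]; simpl.
  pose proof (qpoch_fin_cauchy p hp z hz1 M (n - M)) as h3.
  replace (M + (n - M))%nat with n in h3 by lia.
  replace (qpoch_fin z p n - l) with ((qpoch_fin z p n - qpoch_fin z p M) +
    ((qpoch_fin z p M - qpoch_fin x p M) + (qpoch_fin x p M - l))) by ring.
  eapply Rle_lt_trans; [apply Cmod_triangle|].
  eapply Rle_lt_trans; [apply Rplus_le_compat_l, Cmod_triangle|lra].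
Qed.

(** Splitting off finitely many factors brings any argument into the small disc
    treated above. *)
Lemma cconv_qpoch_aux (p : R) (hp : (0 < p < 1)%R) (x : C) :
  exists N, (forall m, (N <= m)%nat -> (Cmod (x * RtoC p ^ m) < (1 - p) / 4)%R) /\
  cconv (fun n z => qpoch_fin z p n) x (qpoch_fin x p N * qpoch (x * RtoC p ^ N) p).
Proof.
destruct (Rpow_small p hp (Cmod x) ((1 - p) / 4)) as [N hN]; [lra|].
exists N.
assert (hN' : forall m, (N <= m)%nat -> (Cmod (x * RtoC p ^ m) < (1 - p) / 4)%R).
  intros m hm; rewrite Cmod_mult, Cmod_RtoC_pow by lra; now apply hN.
split; [exact hN'|].
assert (h1 : tendsto (locally (T := C_UniformSpace) x) (fun z => z * RtoC p ^ N)
   (x * RtoC p ^ N)).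
  apply (tendsto_mult _ _ _ _ _ (tendsto_id x) (tendsto_const _ _)).
pose proof (cconv_comp _ (fun z => z * RtoC p ^ N) x _ h1
  (cconv_qpoch_small p hp _ (hN' N (le_n N)))) as h2.
pose proof (tendsto_mult _ _ _ _ _ (cconv_snd _ _ _ (tendsto_qpoch_fin p N x)) h2) as h3.
cbv beta in h3.
intros e he; destruct (h3 e he) as [P Q [M hM] hQ hPQ].
exists (fun n => (N + M <= n)%nat) Q; [now exists (N + M)%nat|exact hQ|].
intros n z hn hz; cbn [fst snd].
replace n with (N + (n - N))%nat by lia; rewrite qpoch_fin_shift.
apply (hPQ (n - N)%nat z); [apply hM; lia|exact hz].
Qed.

Lemma cconv_qpoch (p : R) (hp : (0 < p < 1)%R) (x : C) :
  cconv (fun n z => qpoch_fin z p n) x (qpoch x p).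
Proof.
destruct (cconv_qpoch_aux p hp x) as [N [_ h]].
now rewrite (qpoch_lim _ _ _ (cconv_pointwise _ _ _ h)).
Qed.

Lemma qpoch_shift (p : R) (hp : (0 < p < 1)%R) (x : C) (N : nat) :
  qpoch x p = qpoch_fin x p N * qpoch (x * RtoC p ^ N) p.
Proof.
apply qpoch_lim; intros e he.
assert (h := tendsto_mult _ _ _ _ _ (tendsto_const eventually (qpoch_fin x p N))
  (cconv_pointwise _ _ _ (cconv_qpoch p hp (x * RtoC p ^ N))) e he).
destruct h as [M hM]; exists (N + M)%nat; intros n hn.
replace n with (N + (n - N))%nat by lia; rewrite qpoch_fin_shift.
apply hM; lia.
Qed.

Lemma qpoch_step (p : R) (hp : (0 < p < 1)%R) (x : C) :
  qpoch x p = (1 - x) * qpoch (RtoC p * x) p.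
Proof.
rewrite (qpoch_shift p hp x 1); simpl.
replace (x * (RtoC p * 1)) with (RtoC p * x) by ring; ring.
Qed.

(** After finitely many nonzero factors the remaining product is within 1/2 of 1. *)
Lemma qpoch_neq_0 (p : R) (hp : (0 < p < 1)%R) (x : C) :
  (forall k, 1 - x * RtoC p ^ k <> 0) -> qpoch x p <> 0.
Proof.
intros h; destruct (cconv_qpoch_aux p hp x) as [N [hN _]].
rewrite (qpoch_shift p hp x N); apply Cmult_neq_0.
- clear hN; induction N as [|N IH]; simpl; [exact C1_nz|].
  now apply Cmult_neq_0.
- set (y := x * RtoC p ^ N).
  assert (hy : (Cmod y < (1 - p) / 4)%R) by now apply hN.
  intros h0.
  destruct (cconv_pointwise _ _ _ (cconv_qpoch p hp y) (1 / 4)%R) as [M hM]; [lra|].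
  specialize (hM M (le_n M)); cbv beta in hM; rewrite h0 in hM.
  pose proof (qpoch_fin_near_1 p hp y (Rlt_le _ _ hy) M) as h1.
  assert (0 < p ^ M)%R by (apply pow_lt; lra).
  assert (h2 : (Cmod 1 <= Cmod (qpoch_fin y p M - 0) + Cmod (qpoch_fin y p M - 1))%R).
    replace (RtoC 1) with ((qpoch_fin y p M - 0) + - (qpoch_fin y p M - 1)) at 1 by ring.
    eapply Rle_trans; [apply Cmod_triangle|]; rewrite Cmod_opp; lra.
  rewrite Cmod_1 in h2; lra.
Qed.
(** * Derivatives of complex-valued functions of a real variable *)

Notation VC := C_R_NormedModule.

Ltac as_R := match goal with |- @eq _ ?a ?b => change (@eq R a b) end.
Ltac as_C := match goal with |- @eq _ ?a ?b => change (@eq C a b) end.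

Lemma tendsto_continuous (h : R -> C) (r : R) :
  tendsto (locally r) h (h r) <->
  continuous (T := R_UniformSpace) (U := C_UniformSpace) h r.
Proof. apply (tendsto_filterlim (locally r) h (h r)). Qed.

Lemma is_derive_C (h : R -> C) (r : R) (l : C) :
  is_derive (K := R_AbsRing) (V := VC) h r l <->
  is_derive (fun x => Re (h x)) r (Re l) /\ is_derive (fun x => Im (h x)) r (Im l).
Proof.
split.
- intros hd; split.
  + exact (filterdiff_comp' (U := R_NormedModule) (V := VC) (W := R_NormedModule)
      h (fun z : C => fst z) r _ (fun z : C => fst z) hd
      (filterdiff_linear _ is_linear_fst)).
  + exact (filterdiff_comp' (U := R_NormedModule) (V := VC) (W := R_NormedModule)
      h (fun z : C => snd z) r _ (fun z : C => snd z) hd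
      (filterdiff_linear _ is_linear_snd)).
- intros [h1 h2].
  pose proof (is_derive_plus (K := R_AbsRing) (V := VC) _ _ _ _ _
    (is_derive_scal_l (K := R_AbsRing) (V := VC) _ _ _ (1, 0)%R h1)
    (is_derive_scal_l (K := R_AbsRing) (V := VC) _ _ _ (0, 1)%R h2)) as h3.
  replace l with (plus (G := VC) (scal (V := VC) (Re l) (1, 0)%R)
     (scal (V := VC) (Im l) (0, 1)%R)).
  + apply is_derive_ext with (2 := h3); intros x; destruct (h x) as [a b].
    unfold plus, scal; simpl; unfold prod_plus, prod_scal, scal, plus, mult; simpl.
    unfold mult; simpl; f_equal; ring.
  + destruct l as [a b].
    unfold plus, scal; simpl; unfold prod_plus, prod_scal, scal, plus, mult; simpl.
    unfold mult; simpl; f_equal; ring.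
Qed.

Lemma is_derive_Cconst (c : C) (r : R) :
  is_derive (K := R_AbsRing) (V := VC) (fun _ : R => c) r (RtoC 0).
Proof. apply (is_derive_const (K := R_AbsRing) (V := VC) c r). Qed.

Lemma is_derive_Cplus (f g : R -> C) (r : R) (df dg : C) :
  is_derive (K := R_AbsRing) (V := VC) f r df ->
  is_derive (K := R_AbsRing) (V := VC) g r dg ->
  is_derive (K := R_AbsRing) (V := VC) (fun x => f x + g x) r (df + dg).
Proof. apply (is_derive_plus (K := R_AbsRing) (V := VC)). Qed.

Lemma is_derive_Cmult (f g : R -> C) (r : R) (df dg : C) :
  is_derive (K := R_AbsRing) (V := VC) f r df ->
  is_derive (K := R_AbsRing) (V := VC) g r dg ->
  is_derive (K := R_AbsRing) (V := VC) (fun x => f x * g x) r (df * g r + f r * dg).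
Proof.
intros hf hg; apply is_derive_C in hf; apply is_derive_C in hg; apply is_derive_C.
destruct hf as [hf1 hf2], hg as [hg1 hg2]; split; simpl.
- evar_last.
    apply (is_derive_minus (fun x => Re (f x) * Re (g x))%R (fun x => Im (f x) * Im (g x))%R).
      apply (is_derive_mult (fun x => Re (f x)) (fun x => Re (g x)) r _ _ hf1 hg1 Rmult_comm).
    apply (is_derive_mult (fun x => Im (f x)) (fun x => Im (g x)) r _ _ hf2 hg2 Rmult_comm).
  unfold plus, minus, opp, plus, mult, Re, Im; simpl.
  unfold plus, opp, mult; simpl; ring.
- evar_last.
    apply (is_derive_plus (fun x => Re (f x) * Im (g x))%R (fun x => Im (f x) * Re (g x))%R).
      apply (is_derive_mult (fun x => Re (f x)) (fun x => Im (g x)) r _ _ hf1 hg2 Rmult_comm).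
    apply (is_derive_mult (fun x => Im (f x)) (fun x => Re (g x)) r _ _ hf2 hg1 Rmult_comm).
  unfold plus, minus, opp, plus, mult, Re, Im; simpl.
  unfold plus, opp, mult; simpl; ring.
Qed.

Lemma is_derive_Cinv (f : R -> C) (r : R) (df : C) :
  f r <> 0 ->
  is_derive (K := R_AbsRing) (V := VC) f r df ->
  is_derive (K := R_AbsRing) (V := VC) (fun x => / f x) r (- df / (f r * f r)).
Proof.
intros h0 hf; apply is_derive_C in hf; apply is_derive_C.
destruct hf as [h1 h2].
assert (hn : (Re (f r) * Re (f r) + Im (f r) * Im (f r) <> 0)%R).
  intros h; apply h0; destruct (f r) as [a b]; simpl in h.
  assert (a = 0 /\ b = 0)%R as [-> ->] by (split; nra); reflexivity.
assert (hd : is_derive (fun x => Re (f x) * Re (f x) + Im (f x) * Im (f x))%R r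
    (2 * (Re (f r) * Re df + Im (f r) * Im df))%R).
  evar_last.
    apply (is_derive_plus (fun x => Re (f x) * Re (f x))%R (fun x => Im (f x) * Im (f x))%R).
      apply (is_derive_mult (fun x => Re (f x)) (fun x => Re (f x)) r _ _ h1 h1 Rmult_comm).
    apply (is_derive_mult (fun x => Im (f x)) (fun x => Im (f x)) r _ _ h2 h2 Rmult_comm).
  unfold plus, mult; simpl; unfold mult; simpl; ring.
split.
- apply (is_derive_ext (fun x => Re (f x) / (Re (f x) * Re (f x) + Im (f x) * Im (f x)))%R).
    intros x; destruct (f x) as [a b]; simpl; now rewrite !Rmult_1_r.
  evar_last; [apply (is_derive_div _ _ r _ _ h1 hd hn)|].
  destruct (f r) as [a b], df as [c d]; simpl in *; as_R; field.
  split; [|exact hn]; intros h; apply hn.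
  assert (h' : ((a * a + b * b) * (a * a + b * b) = 0)%R) by (rewrite <- h; ring).
  destruct (Rmult_integral _ _ h'); assumption.
- apply (is_derive_ext (fun x => (- Im (f x)) / (Re (f x) * Re (f x) + Im (f x) * Im (f x)))%R).
    intros x; destruct (f x) as [a b]; simpl; now rewrite !Rmult_1_r.
  evar_last; [apply (is_derive_div _ _ r _ _ (is_derive_opp _ _ _ h2) hd hn)|].
  unfold opp; simpl.
  destruct (f r) as [a b], df as [c d]; simpl in *; as_R; field.
  split; [|exact hn]; intros h; apply hn.
  assert (h' : ((a * a + b * b) * (a * a + b * b) = 0)%R) by (rewrite <- h; ring).
  destruct (Rmult_integral _ _ h'); assumption.
Qed.

Lemma is_derive_Cpow (f : R -> C) (r : R) (df : C) (n : nat) :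
  is_derive (K := R_AbsRing) (V := VC) f r df ->
  is_derive (K := R_AbsRing) (V := VC) (fun x => f x ^ S n) r
    (RtoC (INR (S n)) * f r ^ n * df).
Proof.
intros hf; induction n as [|n IH].
  apply (is_derive_ext f); [intros x; as_C; simpl; ring|].
  evar_last; [exact hf|as_C; simpl; ring].
apply (is_derive_ext (fun x => f x * f x ^ S n)); [reflexivity|].
evar_last; [apply (is_derive_Cmult _ _ _ _ _ hf IH)|].
rewrite (S_INR (S n)), RtoC_plus; as_C; simpl Cpow; ring.
Qed.

Lemma path_tendsto (p : path) (r : R) : tendsto (locally r) p (p r).
Proof.
apply tendsto_continuous.
apply (ex_derive_continuous (K := R_AbsRing) (V := VC) p r).
exists (vel p r); apply pos_derive.
Qed.

Lemma vel_tendsto (p : path) (r : R) : tendsto (locally r) (vel p) (vel p r).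
Proof. apply tendsto_continuous, vel_continuous. Qed.

Lemma tendsto_path (p : path) (r : R) (f : C -> C) (l : C) :
  tendsto (locally (T := C_UniformSpace) (p r)) f l ->
  tendsto (locally r) (fun x => f (p x)) l.
Proof.
apply tendsto_comp; exact (proj1 (tendsto_filterlim _ _ _) (path_tendsto p r)).
Qed.

(** * Contour integrals and cycles *)

Definition is_pint (f : C -> C) (p : path) (w : C) : Prop :=
  is_RInt (V := VC) (fun r : R => f (p r) * vel p r) 0 1 w.

(** The relational form carries integrability along, which the total operator
    [contour_integral] does not. *)
Fixpoint is_cint (f : C -> C) (g : list path) (w : C) : Prop :=
  match g with
  | nil => w = 0
  | p :: g' => exists a b, is_pint f p a /\ is_cint f g' b /\ w = a + b
  end.

Lemma is_cint_unique f g (w : C) : is_cint f g w -> contour_integral f g = w.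
Proof.
revert w; induction g as [|p g IH]; simpl; intros w; [easy|].
intros (a & b & ha & hb & ->); unfold contour_integral; simpl.
f_equal; [|exact (IH b hb)].
exact (is_RInt_unique (V := C_R_CompleteNormedModule) _ _ _ _ ha).
Qed.

Lemma is_cint_app f g g' (w w' : C) :
  is_cint f g w -> is_cint f g' w' -> is_cint f (g ++ g') (w + w').
Proof.
revert w; induction g as [|p g IH]; simpl; intros w.
  now intros -> h; replace (0 + w') with w' by ring.
intros (a & b & ha & hb & ->) h; exists a, (b + w').
split; [exact ha|]; split; [now apply IH|ring].
Qed.

Lemma is_pint_ext f f' (p : path) (w : C) :
  (forall r, (0 <= r <= 1)%R -> f (p r) = f' (p r)) -> is_pint f p w -> is_pint f' p w.
Proof.
intros h; apply is_RInt_ext; intros r hr.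
rewrite Rmin_left, Rmax_right in hr by lra; rewrite h; [reflexivity|lra].
Qed.

Lemma is_cint_ext f f' (g : list path) (w : C) :
  (forall p, In p g -> forall r, (0 <= r <= 1)%R -> f (p r) = f' (p r)) ->
  is_cint f g w -> is_cint f' g w.
Proof.
revert w; induction g as [|p g IH]; simpl; intros w h; [easy|].
intros (a & b & ha & hb & ->); exists a, b; split; [|split; [|reflexivity]].
- now apply is_pint_ext with (2 := ha), h; left.
- apply IH with (2 := hb); intros p' hp'; apply h; now right.
Qed.

Lemma is_cint_plus f f' g (w w' : C) :
  is_cint f g w -> is_cint f' g w' -> is_cint (fun z => f z + f' z) g (w + w').
Proof.
revert w w'; induction g as [|p g IH]; simpl; intros w w'.
  intros -> ->; ring.
intros (a & b & ha & hb & ->) (a' & b' & ha' & hb' & ->).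
exists (a + a'), (b + b'); split; [|split; [now apply IH|ring]].
apply is_RInt_ext with (2 := is_RInt_plus (V := VC) _ _ _ _ _ _ ha ha').
intros r _; change (f (p r) * vel p r + f' (p r) * vel p r =
  (f (p r) + f' (p r)) * vel p r); ring.
Qed.

Lemma is_RInt_Cscal (h : R -> C) (c w : C) (a b : R) :
  is_RInt (V := VC) h a b w -> is_RInt (V := VC) (fun r => c * h r) a b (c * w).
Proof.
intros hh.
pose proof (is_RInt_fct_extend_fst (U := R_NormedModule) (V := R_NormedModule) _ _ _ _ hh) as h1.
pose proof (is_RInt_fct_extend_snd (U := R_NormedModule) (V := R_NormedModule) _ _ _ _ hh) as h2.
apply (is_RInt_fct_extend_pair (U := R_NormedModule) (V := R_NormedModule)
  (fun r => c * h r) a b (Re (c * w)) (Im (c * w))).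
- exact (is_RInt_minus (V := R_NormedModule) _ _ _ _ _ _
    (is_RInt_scal (V := R_NormedModule) _ _ _ (Re c) _ h1)
    (is_RInt_scal (V := R_NormedModule) _ _ _ (Im c) _ h2)).
- exact (is_RInt_plus (V := R_NormedModule) _ _ _ _ _ _
    (is_RInt_scal (V := R_NormedModule) _ _ _ (Re c) _ h2)
    (is_RInt_scal (V := R_NormedModule) _ _ _ (Im c) _ h1)).
Qed.

Lemma is_cint_scal f g (c w : C) :
  is_cint f g w -> is_cint (fun z => c * f z) g (c * w).
Proof.
revert w; induction g as [|p g IH]; simpl; intros w.
  intros ->; ring.
intros (a & b & ha & hb & ->); exists (c * a), (c * b).
split; [|split; [now apply IH|ring]].
apply is_RInt_ext with (2 := is_RInt_Cscal _ c _ _ _ ha).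
intros r _; change (c * (f (p r) * vel p r) = c * f (p r) * vel p r); ring.
Qed.

Lemma is_cint_exists f (g : list path) :
  (forall p, In p g -> forall r, (0 <= r <= 1)%R ->
     tendsto (locally (T := C_UniformSpace) (p r)) f (f (p r))) ->
  exists w : C, is_cint f g w.
Proof.
induction g as [|p g IH]; intros h; [now exists (RtoC 0)|].
destruct IH as [b hb]; [intros p' hp'; apply h; now right|].
assert (ha : ex_RInt (V := C_R_CompleteNormedModule) (fun r => f (p r) * vel p r) 0 1).
  apply ex_RInt_continuous; intros r hr.
  rewrite Rmin_left, Rmax_right in hr by lra.
  apply tendsto_continuous.
  exact (tendsto_mult _ _ _ _ _ (tendsto_path p r f _ (h p (or_introl eq_refl) r hr))
    (vel_tendsto p r)).
destruct ha as [a ha]; exists (a + b), a, b; now split.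
Qed.

(** Stands for a formal sum of closed curves: the curves need not be joined to each
    other, and all that is used of closedness is that derivatives integrate to 0. *)
Definition cycle (g : list path) : Prop :=
  forall F f : C -> C,
  (forall p, In p g -> forall r, (0 <= r <= 1)%R ->
     is_derive (K := R_AbsRing) (V := VC) (fun x => F (p x)) r (f (p r) * vel p r) /\
     tendsto (locally r) (fun x => f (p x) * vel p x) (f (p r) * vel p r)) ->
  is_cint f g 0.

Lemma closed_curve_cycle (g : list path) : closed_curve g -> cycle g.
Proof.
intros [z hz] F f h.
enough (H : forall z' w, chain z' g w -> is_cint f g (F w - F z')).
  replace (RtoC 0) with (F z - F z) by ring; now apply H.
clear hz z; induction g as [|p g IH]; simpl; intros z w hc; [subst; ring|].
destruct hc as [hz hc]; exists (F (p 1%R) - F z), (F w - F (p 1%R)).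
split; [|split; [apply IH; [|exact hc]|ring]].
- rewrite <- hz; unfold is_pint.
  apply (is_RInt_derive (V := C_R_CompleteNormedModule) (fun r => F (p r))).
  + intros r hr; rewrite Rmin_left, Rmax_right in hr by lra.
    apply h; [now left|exact hr].
  + intros r hr; rewrite Rmin_left, Rmax_right in hr by lra.
    apply (tendsto_continuous (fun x => f (p x) * vel p x)).
    apply h; [now left|exact hr].
- intros p' hp'; apply h; now right.
Qed.

Lemma cycle_app (g g' : list path) : cycle g -> cycle g' -> cycle (g ++ g').
Proof.
intros h h' F f H; replace (RtoC 0) with (0 + 0) by ring.
apply is_cint_app; [apply (h F)|apply (h' F)]; intros p hp; apply H, in_or_app; tauto.
Qed.

Lemma tendsto_sub_pow (c z : C) (n : nat) :
  tendsto (locally (T := C_UniformSpace) z) (fun w => (w - c) ^ n) ((z - c) ^ n).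
Proof.
induction n as [|n IH]; simpl; [apply tendsto_const; typeclasses eauto|].
apply (tendsto_mult _ _ _ _ _ (tendsto_plus _ _ _ _ _ (tendsto_id z) (tendsto_const _ _)) IH).
Qed.

Lemma is_derive_path_minus (p : path) (c : C) (r : R) :
  is_derive (K := R_AbsRing) (V := VC) (fun x => p x - c) r (vel p r).
Proof.
evar_last; [apply (is_derive_Cplus _ _ _ _ _ (pos_derive p r) (is_derive_Cconst (- c) r))|].
simpl; ring.
Qed.

Lemma INR_S_neq_0 (n : nat) : RtoC (INR (S n)) <> 0.
Proof. intros h; apply RtoC_inj in h; exact (not_0_INR (S n) (Nat.neq_succ_0 n) h). Qed.

Lemma cycle_pow (g : list path) (c : C) (n : nat) :
  cycle g -> is_cint (fun z => (z - c) ^ n) g 0.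
Proof.
intros hg; apply (hg (fun z => / RtoC (INR (S n)) * (z - c) ^ S n)).
intros p _ r _; split.
- evar_last.
    apply (is_derive_Cmult _ _ _ _ _ (is_derive_Cconst (/ RtoC (INR (S n))) r)
      (is_derive_Cpow _ _ _ n (is_derive_path_minus p c r))).
  cbv beta; as_C; field; exact (INR_S_neq_0 n).
- exact (tendsto_mult _ _ _ _ _
    (tendsto_path p r (fun z => (z - c) ^ n) _ (tendsto_sub_pow c (p r) n))
    (vel_tendsto p r)).
Qed.

Lemma cycle_inv_pow (g : list path) (c : C) (n : nat) :
  cycle g -> avoids g c -> is_cint (fun z => / (z - c) ^ S (S n)) g 0.
Proof.
intros hg hc.
apply (hg (fun z => - / RtoC (INR (S n)) * / (z - c) ^ S n)).
intros p hp r hr.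
assert (h0 : p r - c <> 0).
  intros h; apply (hc p hp r hr); replace (p r) with (p r - c + c) by ring.
  rewrite h; ring.
split.
- pose proof (is_derive_Cinv (fun x => (p x - c) ^ S n) r _ (Cpow_nz _ _ h0)
    (is_derive_Cpow _ _ _ n (is_derive_path_minus p c r))) as hd.
  evar_last.
    apply (is_derive_Cmult _ _ _ _ _ (is_derive_Cconst (- / RtoC (INR (S n))) r) hd).
  cbv beta; simpl Cpow; as_C; field; repeat split; try assumption.
    now apply Cpow_nz.
  exact (INR_S_neq_0 n).
- refine (tendsto_mult _ (fun x => / (p x - c) ^ S (S n)) (vel p) _ _
    (tendsto_path p r (fun z => / (z - c) ^ S (S n)) (/ (p r - c) ^ S (S n)) _)
    (vel_tendsto p r)).
  apply (tendsto_inv _ (fun z => (z - c) ^ S (S n))); [now apply Cpow_nz|].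
  apply tendsto_sub_pow.
Qed.
(** * Passage to the limit under the integral sign *)

Lemma uniform_of_joint (hn : nat -> R -> C) (h : R -> C) :
  (forall r, (0 <= r <= 1)%R ->
     tendsto (filter_prod eventually (locally r)) (fun nr => hn (fst nr) (snd nr)) (h r)) ->
  forall e : R, (0 < e)%R -> exists N, forall n, (N <= n)%nat ->
    forall r, (0 <= r <= 1)%R -> (Cmod (hn n r - h r) < e)%R.
Proof.
intros H e he.
assert (he3 : (0 < e / 3)%R) by lra.
(* [delta r] encodes both the size of a neighbourhood of [r] and, through its
   inverse, an index from which the estimate holds there; a positive lower bound
   on it over [0, 1] then gives a common index *)
assert (hd : forall r, exists delta : posreal, (0 <= r <= 1)%R ->
    forall n x, (/ delta < INR n + 1)%R -> (Rabs (x - r) < delta)%R ->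
      (Cmod (hn n x - h r) < e / 3)%R).
  intros r; destruct (classic (0 <= r <= 1)%R) as [hr|hr];
    [|exists (mkposreal 1 Rlt_0_1); tauto].
  destruct (H r hr _ he3) as [P Q [N hN] [d hQ] hPQ].
  assert (hN0 : (0 < INR N + 1)%R) by (pose proof (pos_INR N); lra).
  assert (hm : (0 < Rmin d (/ (INR N + 1)))%R).
    apply Rmin_glb_lt; [apply cond_pos|now apply Rinv_0_lt_compat].
  exists (mkposreal _ hm); intros _ n x hn' hx; simpl in *.
  apply (hPQ n x); [apply hN|apply hQ].
  - apply Nat.lt_le_incl, INR_lt.
    assert (INR N + 1 <= / Rmin d (/ (INR N + 1)))%R; [|lra].
    rewrite <- (Rinv_inv (INR N + 1)) at 1.
    apply Rinv_le_contravar; [exact hm|apply Rmin_r].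
  - apply Rlt_le_trans with (1 := hx), Rmin_l.
destruct (functional_choice _ hd) as [delta hdelta].
destruct (compactness_value_1d 0 1 delta) as [d hdc].
destruct (nfloor_ex (/ d)) as [N [_ hN]].
  apply Rlt_le, Rinv_0_lt_compat, cond_pos.
exists N; intros n hn' x hx.
apply NNPP; intros hneg; apply (hdc x hx); intros (t & ht & hxt & hdt); apply hneg.
assert (hbig : forall m, (N <= m)%nat -> (Cmod (hn m x - h t) < e / 3)%R).
  intros m hm; apply (hdelta t ht m x); [|exact hxt].
  apply Rle_lt_trans with (/ d)%R.
    apply Rinv_le_contravar; [apply cond_pos|exact hdt].
  apply Rlt_le_trans with (1 := hN), Rplus_le_compat_r, le_INR, hm.
destruct (H x hx _ he3) as [P Q [M hM] hQ hPQ].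
assert (hx0 := hPQ (Nat.max n M) x (hM _ (Nat.le_max_r _ _)) (locally_singleton _ _ hQ)).
simpl in hx0.
replace (hn n x - h x) with ((hn n x - h t) +
  (- (hn (Nat.max n M) x - h t) + (hn (Nat.max n M) x - h x))) by ring.
eapply Rle_lt_trans; [apply Cmod_triangle|].
eapply Rle_lt_trans; [apply Rplus_le_compat_l, Cmod_triangle|]; rewrite Cmod_opp.
pose proof (hbig n hn'); pose proof (hbig (Nat.max n M) ltac:(lia)); lra.
Qed.

Lemma is_RInt_limit (hn : nat -> R -> C) (h : R -> C) (w : nat -> C) :
  (forall r, (0 <= r <= 1)%R ->
     tendsto (filter_prod eventually (locally r)) (fun nr => hn (fst nr) (snd nr)) (h r)) ->
  (forall n, is_RInt (V := VC) (hn n) 0 1 (w n)) ->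
  exists l : C, tendsto eventually w l /\ is_RInt (V := VC) h 0 1 l.
Proof.
intros H hw.
(* [filterlim_RInt] wants uniform convergence on the whole line, so clamp to [0, 1] *)
pose (restr := fun (k : R -> C) r => k (Rmax 0 (Rmin r 1))).
assert (hrestr : forall k r, (0 <= r <= 1)%R -> restr k r = k r).
  intros k r hr; unfold restr; now rewrite Rmin_left, Rmax_right by lra.
destruct (filterlim_RInt (V := C_R_CompleteNormedModule) (fun n => restr (hn n)) 0 1
  eventually _ (restr h) w) as [l [hl1 hl2]].
- intros n; apply is_RInt_ext with (2 := hw n).
  intros r hr; rewrite Rmin_left, Rmax_right in hr by lra; rewrite hrestr by lra; reflexivity.
- apply (proj2 (filterlim_locally (U := fct_UniformSpace R C_UniformSpace) _ _)).
  intros e; destruct (uniform_of_joint hn h H e (cond_pos e)) as [N hN].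
  exists N; intros n hn' r.
  unfold restr; apply (norm_compat1 (V := VC)).
  rewrite <- Cmod_norm; apply (hN n hn').
  split; [apply Rmax_l|apply Rmax_lub; [lra|apply Rmin_r]].
- exists l; split; [now apply tendsto_filterlim; [typeclasses eauto|]|].
  apply is_RInt_ext with (2 := hl2).
  intros r hr; rewrite Rmin_left, Rmax_right in hr by lra; apply hrestr; lra.
Qed.

Lemma tendsto_unique (w : nat -> C) (l m : C) :
  tendsto eventually w l -> tendsto eventually w m -> l = m.
Proof.
intros hl hm; apply NNPP; intros hlm.
assert (hd : (0 < Cmod (l - m))%R).
  apply Cmod_gt_0; intros h; apply hlm.
  replace l with (l - m + m) by ring; rewrite h; ring.
assert (hd2 : (0 < Cmod (l - m) / 2)%R) by lra.
destruct (filter_and _ _ (hl _ hd2) (hm _ hd2)) as [N hN].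
destruct (hN N (le_n N)) as [h1 h2].
assert (Cmod (l - m) <= Cmod (w N - l) + Cmod (w N - m))%R; [|lra].
replace (l - m) with (- (w N - l) + (w N - m)) by ring.
eapply Rle_trans; [apply Cmod_triangle|]; rewrite Cmod_opp; lra.
Qed.

Lemma is_cint_limit (fn : nat -> C -> C) (f : C -> C) (g : list path) (w : nat -> C) :
  (forall p, In p g -> forall r, (0 <= r <= 1)%R -> cconv fn (p r) (f (p r))) ->
  (forall n, is_cint (fn n) g (w n)) ->
  exists l : C, tendsto eventually w l /\ is_cint f g l.
Proof.
revert w; induction g as [|p g IH]; intros w H hw.
  exists (RtoC 0); split; [|reflexivity].
  apply (tendsto_ext _ (fun _ => RtoC 0)); [|apply tendsto_const; typeclasses eauto].
  exists O; intros n _; symmetry; exact (hw n).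
assert (hc : forall n, exists ab : C * C,
    is_pint (fn n) p (fst ab) /\ is_cint (fn n) g (snd ab) /\ w n = fst ab + snd ab).
  intros n; destruct (hw n) as (a & b & h); now exists (a, b).
destruct (functional_choice _ hc) as [ab hab].
destruct (is_RInt_limit (fun n r => fn n (p r) * vel p r) (fun r => f (p r) * vel p r)
  (fun n => fst (ab n))) as [a [ha1 ha2]].
- intros r hr.
  apply (tendsto_mult _ (fun nr : nat * R => fn (fst nr) (p (snd nr)))
    (fun nr : nat * R => vel p (snd nr))).
  + apply (tendsto_comp _ (joint (p r)) (fun nr : nat * R => (fst nr, p (snd nr)))
      (fun nz => fn (fst nz) (snd nz)) (f (p r))); [|now apply H; [left|]].
    apply (filterlim_pair (fun nr : nat * R => fst nr) (fun nr : nat * R => p (snd nr))).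
      apply filterlim_fst.
    apply filterlim_comp with (2 := proj1 (tendsto_filterlim _ _ _) (path_tendsto p r)).
    apply filterlim_snd.
  + apply (tendsto_comp _ (locally r) (fun nr : nat * R => snd nr) (vel p)).
      apply filterlim_snd.
    apply vel_tendsto.
- intros n; apply hab.
- destruct (IH (fun n => snd (ab n))) as [b [hb1 hb2]].
    intros p' hp'; apply H; now right.
    intros n; apply hab.
  exists (a + b); split; [|now exists a, b].
  apply (tendsto_ext _ (fun n => fst (ab n) + snd (ab n))).
    exists O; intros n _; symmetry; apply hab.
  now apply (tendsto_plus _ _ _ _ _).
Qed.

(** * Homological invariance of contour integrals *)

Definition same_integral (g1 g2 : list path) (f : C -> C) : Prop :=
  exists w : C, is_cint f g1 w /\ is_cint f g2 w.

Definition avoids_set (g : list path) (Z : C -> Prop) : Prop :=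
  forall z, Z z -> avoids g z.

Lemma same_integral_plus g1 g2 (f f' : C -> C) :
  same_integral g1 g2 f -> same_integral g1 g2 f' -> same_integral g1 g2 (fun z => f z + f' z).
Proof.
intros (w & h1 & h2) (w' & h1' & h2'); exists (w + w'); now split; apply is_cint_plus.
Qed.

Lemma same_integral_scal g1 g2 (f : C -> C) (c : C) :
  same_integral g1 g2 f -> same_integral g1 g2 (fun z => c * f z).
Proof. intros (w & h1 & h2); exists (c * w); now split; apply is_cint_scal. Qed.

Lemma same_integral_ext g1 g2 (Z : C -> Prop) (f f' : C -> C) :
  avoids_set g1 Z -> avoids_set g2 Z -> (forall z, ~ Z z -> f z = f' z) ->
  same_integral g1 g2 f -> same_integral g1 g2 f'.
Proof.
intros a1 a2 h (w & h1 & h2); exists w.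
split; [apply is_cint_ext with (2 := h1)|apply is_cint_ext with (2 := h2)];
  intros p hp r hr; apply h; intros hz;
  [apply (a1 _ hz p hp r hr)|apply (a2 _ hz p hp r hr)]; reflexivity.
Qed.

Lemma Ctwo_pi_i_neq_0 : 2 * PI * Ci <> 0.
Proof.
intros h; assert (h' := f_equal Im h); simpl in h'; pose proof PI_RGT_0; lra.
Qed.

Lemma is_cint_winding (g : list path) (c : C) :
  avoids g c -> is_cint (fun z => / (z - c)) g (2 * PI * Ci * winding g c).
Proof.
intros hc.
destruct (is_cint_exists (fun z : C => / (z - c)) g) as [w hw].
  intros p hp r hr.
  apply (tendsto_inv _ (fun z : C => z - c)); [apply Cminus_eq_contra; now apply hc|].
  apply (tendsto_plus _ _ _ _ _ (tendsto_id (p r)) (tendsto_const _ _)).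
unfold winding; rewrite (is_cint_unique _ _ _ hw).
replace (2 * PI * Ci * (/ (2 * PI * Ci) * w)) with w; [exact hw|].
rewrite Cmult_assoc, Cinv_r, Cmult_1_l; [reflexivity|exact Ctwo_pi_i_neq_0].
Qed.

Fixpoint polar (l : list C) (z : C) : C :=
  match l with
  | nil => 1
  | c :: l' => / (z - c) * polar l' z
  end.

Lemma polar_app (l l' : list C) (z : C) : polar (l ++ l') z = polar l z * polar l' z.
Proof. induction l as [|c l IH]; simpl; [ring|rewrite IH; ring]. Qed.

Lemma polar_const (c : C) (l : list C) (z : C) :
  z - c <> 0 -> List.Forall (eq c) l -> polar l z = / (z - c) ^ length l.
Proof.
intros hz; induction 1 as [|d l <- _ IH]; simpl; [field|].
rewrite IH; field; split; [now apply Cpow_nz|exact hz].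
Qed.

(** Partial fractions, as an induction on the number of factors.  A factor z of the
    numerator is written (z - c) + c, and two distinct poles are separated by
    1/((z - c)(z - d)) = (1/(z - c) - 1/(z - d))/(c - d); what is left are powers of
    z, powers 1/(z - c)^n with n >= 2, which have primitives, and 1/(z - c). *)
Lemma same_integral_monomial (g1 g2 : list path) (Z : C -> Prop) :
  cycle g1 -> cycle g2 -> avoids_set g1 Z -> avoids_set g2 Z ->
  (forall c, Z c -> winding g1 c = winding g2 c) ->
  forall (k m : nat) (l : list C), (m + length l <= k)%nat -> List.Forall Z l ->
  same_integral g1 g2 (fun z => z ^ m * polar l z).
Proof.
intros c1 c2 a1 a2 hw k; induction k as [k IH] using (well_founded_induction lt_wf).
intros m l hk hl.
destruct l as [|c l].
  apply (same_integral_ext _ _ Z (fun z => (z - 0) ^ m) _ a1 a2).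
    intros z _; simpl; replace (z - 0) with z by ring; ring.
  exists (RtoC 0); split; now apply cycle_pow.
assert (hz0 : forall z d, ~ Z z -> Z d -> z - d <> 0).
  intros z d h1 h2; apply Cminus_eq_contra; now intros ->.
inversion hl as [|c' l' hc hl' [e1 e2]]; subst c' l'.
destruct m as [|m].
- destruct (classic (List.Forall (eq c) l)) as [hall|hall].
  + destruct l as [|d l].
      apply (same_integral_ext _ _ Z (fun z => / (z - c)) _ a1 a2).
        intros z hz; simpl; ring.
      exists (2 * PI * Ci * winding g1 c); split; [now apply is_cint_winding, a1|].
      rewrite (hw c hc); now apply is_cint_winding, a2.
    apply (same_integral_ext _ _ Z (fun z => / (z - c) ^ S (S (length l))) _ a1 a2).
      intros z hz.
      rewrite (polar_const c (c :: d :: l)); [simpl; ring|now apply hz0|].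
      constructor; [reflexivity|exact hall].
    exists (RtoC 0); split; apply cycle_inv_pow; auto.
  + assert (hd : exists d, In d l /\ c <> d).
      apply NNPP; intros h; apply hall, List.Forall_forall; intros d hd.
      apply NNPP; intros hcd; apply h; now exists d.
    destruct hd as (d & hd & hcd).
    destruct (in_split _ _ hd) as (l1 & l2 & ->).
    rewrite List.Forall_app in hl'; destruct hl' as [hl1 hl2].
    inversion hl2 as [|d' l2' hd' hl2' [e1 e2]]; subst d' l2'.
    rewrite length_cons, length_app, length_cons in hk.
    assert (hA : forall b, Z b -> same_integral g1 g2 (fun z => z ^ 0 * polar (b :: l1 ++ l2) z)).
      intros b hb; apply (IH (k - 1)%nat); [lia| |].
        rewrite length_cons, length_app; lia.
      constructor; [exact hb|now apply List.Forall_app].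
    apply (same_integral_ext _ _ Z (fun z => / (c - d) * (z ^ 0 * polar (c :: l1 ++ l2) z) +
       - / (c - d) * (z ^ 0 * polar (d :: l1 ++ l2) z)) _ a1 a2).
      intros z hz; simpl; rewrite !polar_app; simpl; field.
      repeat split; try (now apply hz0); now apply Cminus_eq_contra.
    apply same_integral_plus; apply same_integral_scal; now apply hA.
- apply (same_integral_ext _ _ Z
    (fun z => z ^ m * polar l z + c * (z ^ m * polar (c :: l) z)) _ a1 a2).
    intros z hz; simpl; field; now apply hz0.
  simpl in hk.
  apply same_integral_plus; [|apply same_integral_scal]; apply (IH (k - 1)%nat); simpl; auto; lia.
Qed.

(** The values on [Z], where a total inverse gives them no meaning, are left free
    by [rational_ext]. *)
Inductive rational (Z : C -> Prop) : (C -> C) -> Prop :=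
| rational_one : rational Z (fun _ => 1)
| rational_plus f f' : rational Z f -> rational Z f' -> rational Z (fun z => f z + f' z)
| rational_scal c f : rational Z f -> rational Z (fun z => c * f z)
| rational_mul f : rational Z f -> rational Z (fun z => z * f z)
| rational_div c f : Z c -> rational Z f -> rational Z (fun z => / (z - c) * f z)
| rational_ext f f' : (forall z, ~ Z z -> f z = f' z) -> rational Z f -> rational Z f'.

(** The statement is strengthened by a factor z^m / prod (z - c), which absorbs
    the constructors one by one. *)
Lemma same_integral_rational (g1 g2 : list path) (Z : C -> Prop) (f : C -> C) :
  cycle g1 -> cycle g2 -> avoids_set g1 Z -> avoids_set g2 Z ->
  (forall c, Z c -> winding g1 c = winding g2 c) -> rational Z f ->
  same_integral g1 g2 f.
Proof.
intros c1 c2 a1 a2 hw hf.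
enough (H : forall m l, List.Forall Z l ->
    same_integral g1 g2 (fun z => f z * (z ^ m * polar l z))).
  apply (same_integral_ext _ _ Z (fun z => f z * (z ^ 0 * polar nil z)) _ a1 a2).
    intros z _; simpl; ring.
  apply H; constructor.
induction hf as [|f f' _ IH _ IH'|c f _ IH|f _ IH|c f hc _ IH|f f' h _ IH]; intros m l hl.
- apply (same_integral_ext _ _ Z (fun z => z ^ m * polar l z) _ a1 a2); [intros z _; ring|].
  now apply (same_integral_monomial g1 g2 Z c1 c2 a1 a2 hw (m + length l)).
- apply (same_integral_ext _ _ Z (fun z => f z * (z ^ m * polar l z) + f' z * (z ^ m * polar l z))
    _ a1 a2); [intros z _; ring|].
  apply same_integral_plus; auto.
- apply (same_integral_ext _ _ Z (fun z => c * (f z * (z ^ m * polar l z))) _ a1 a2);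
    [intros z _; ring|].
  apply same_integral_scal; auto.
- apply (same_integral_ext _ _ Z (fun z => f z * (z ^ S m * polar l z)) _ a1 a2);
    [intros z _; simpl; ring|auto].
- apply (same_integral_ext _ _ Z (fun z => f z * (z ^ m * polar (c :: l) z)) _ a1 a2);
    [intros z _; simpl; ring|auto].
- apply (same_integral_ext _ _ Z (fun z => f z * (z ^ m * polar l z)) _ a1 a2);
    [intros z hz; now rewrite h|auto].
Qed.

Lemma rational_mult Z f f' : rational Z f -> rational Z f' -> rational Z (fun z => f z * f' z).
Proof.
intros hf hf'; induction hf as [|f1 f2 _ IH1 _ IH2|c f _ IH|f _ IH|c f hc _ IH|f1 f2 h _ IH].
- apply rational_ext with (2 := hf'); intros z _; ring.
- apply rational_ext with (2 := rational_plus _ _ _ IH1 IH2); intros z _; ring.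
- apply rational_ext with (2 := rational_scal _ c _ IH); intros z _; ring.
- apply rational_ext with (2 := rational_mul _ _ IH); intros z _; ring.
- apply rational_ext with (2 := rational_div _ c _ hc IH); intros z _; ring.
- apply rational_ext with (2 := IH); intros z hz; now rewrite h.
Qed.

(** The poles of all the approximants stay in [Z], so the winding numbers about [Z]
    control all their integrals at once. *)
Definition rational_limit (Z : C -> Prop) (f : C -> C) : Prop :=
  exists fn : nat -> C -> C, (forall n, rational Z (fn n)) /\
    forall z, ~ Z z -> cconv fn z (f z).

Theorem cauchy_homology (g1 g2 : list path) (Z : C -> Prop) (f : C -> C) :
  cycle g1 -> cycle g2 -> avoids_set g1 Z -> avoids_set g2 Z ->
  (forall c, Z c -> winding g1 c = winding g2 c) -> rational_limit Z f ->
  same_integral g1 g2 f.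
Proof.
intros c1 c2 a1 a2 hw (fn & hrat & hlim).
assert (ha : forall n, same_integral g1 g2 (fn n)).
  intros n; now apply (same_integral_rational g1 g2 Z).
destruct (functional_choice _ ha) as [w hw12].
destruct (is_cint_limit fn f g1 w) as (w1 & hl1 & h1).
  intros p hp r hr; apply hlim; intros hz; exact (a1 _ hz p hp r hr eq_refl).
  apply hw12.
destruct (is_cint_limit fn f g2 w) as (w2 & hl2 & h2).
  intros p hp r hr; apply hlim; intros hz; exact (a2 _ hz p hp r hr eq_refl).
  apply hw12.
exists w1; split; [exact h1|].
now rewrite (tendsto_unique _ _ _ hl1 hl2).
Qed.
(** * Winding numbers of circles *)

Definition circle_pos (c : C) (rho : R) (r : R) : C :=
  c + RtoC rho * (cos (2 * PI * r), sin (2 * PI * r))%R.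

Definition circle_vel (rho : R) (r : R) : C :=
  RtoC rho * (2 * PI * (- sin (2 * PI * r)), 2 * PI * cos (2 * PI * r))%R.

Lemma circle_pos_derive (c : C) (rho r : R) :
  is_derive (K := R_AbsRing) (V := VC) (circle_pos c rho) r (circle_vel rho r).
Proof.
apply is_derive_C; split.
- apply (is_derive_ext (fun r => Re c + rho * cos (2 * PI * r))%R).
    intros x; unfold circle_pos; unfold Re, Im; simpl; as_R; ring.
  auto_derive; [exact I|unfold circle_vel, Re, Im; simpl; as_R; ring].
- apply (is_derive_ext (fun r => Im c + rho * sin (2 * PI * r))%R).
    intros x; unfold circle_pos; unfold Re, Im; simpl; as_R; ring.
  auto_derive; [exact I|unfold circle_vel, Re, Im; simpl; as_R; ring].
Qed.

Lemma circle_vel_continuous (rho r : R) :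
  continuous (T := R_UniformSpace) (U := C_UniformSpace) (circle_vel rho) r.
Proof.
apply (ex_derive_continuous (K := R_AbsRing) (V := VC)).
exists (RtoC rho * (2 * PI * (2 * PI) * (- cos (2 * PI * r)),
                    2 * PI * (2 * PI) * (- sin (2 * PI * r)))%R).
apply is_derive_C; split.
- apply (is_derive_ext (fun r => rho * (2 * PI * (- sin (2 * PI * r))))%R).
    intros x; unfold circle_vel; unfold Re, Im; simpl; as_R; ring.
  auto_derive; [exact I|unfold Re, Im; simpl; as_R; ring].
- apply (is_derive_ext (fun r => rho * (2 * PI * cos (2 * PI * r)))%R).
    intros x; unfold circle_vel; unfold Re, Im; simpl; as_R; ring.
  auto_derive; [exact I|unfold Re, Im; simpl; as_R; ring].
Qed.

Definition circle (c : C) (rho : R) : path :=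
  Path (circle_pos c rho) (circle_vel rho) (circle_pos_derive c rho)
    (circle_vel_continuous rho).

Lemma circle_velE (c : C) (rho r : R) :
  vel (circle c rho) r = 2 * PI * Ci * (circle c rho r - c).
Proof.
simpl; unfold circle_vel, circle_pos, RtoC, Ci, Cmult, Cplus, Cminus, Copp; simpl.
f_equal; ring.
Qed.

Lemma circle_cycle (c : C) (rho : R) : cycle (circle c rho :: nil).
Proof.
apply closed_curve_cycle; exists (circle c rho 0); split; [reflexivity|].
simpl; unfold circle_pos.
rewrite Rmult_1_r, Rmult_0_r, cos_2PI, sin_2PI, cos_0, sin_0; reflexivity.
Qed.

Lemma circle_dist (c : C) (rho r : R) :
  (0 < rho)%R -> Cmod (circle c rho r - c) = rho.
Proof.
intros h; simpl; unfold circle_pos.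
replace (c + RtoC rho * (cos (2 * PI * r), sin (2 * PI * r))%R - c)
  with (RtoC rho * (cos (2 * PI * r), sin (2 * PI * r))%R) by ring.
rewrite Cmod_mult, Cmod_R, Rabs_right by lra.
unfold Cmod; simpl.
replace (cos (2 * PI * r) * (cos (2 * PI * r) * 1) +
         sin (2 * PI * r) * (sin (2 * PI * r) * 1))%R with 1%R.
  rewrite sqrt_1; ring.
pose proof (sin2_cos2 (2 * PI * r)) as h2; unfold Rsqr in h2; lra.
Qed.

(* from here on a circle is known only through the lemmas above *)
Opaque circle.

Lemma Cmod_2pii : Cmod (2 * PI * Ci) = (2 * PI)%R.
Proof.
rewrite !Cmod_mult, !Cmod_R, Cmod_Ci, !Rabs_right; [ring| |lra].
apply Rle_ge, Rlt_le, PI_RGT_0.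
Qed.

Lemma circle_bound (c : C) (rho M : R) (f : C -> C) (w : C) :
  (0 < rho)%R -> (forall z, Cmod (z - c) = rho -> (Cmod (f z) <= M)%R) ->
  is_cint f (circle c rho :: nil) w -> (Cmod w <= 2 * PI * rho * M)%R.
Proof.
intros hrho hM (a & b & ha & hb & ->); simpl in hb; subst b.
replace (a + 0) with a by ring; rewrite Cmod_norm.
replace (2 * PI * rho * M)%R with ((1 - 0) * (M * (2 * PI * rho)))%R by ring.
apply (norm_RInt_le_const (V := VC)) with (3 := ha); [lra|].
intros r _; rewrite <- Cmod_norm.
rewrite Cmod_mult, circle_velE, Cmod_mult, Cmod_2pii, circle_dist by exact hrho.
apply Rmult_le_compat_r; [pose proof PI_RGT_0; nra|].
apply hM, circle_dist, hrho.
Qed.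

Lemma circle_avoids (c : C) (rho : R) (z : C) :
  (0 < rho)%R -> Cmod (z - c) <> rho -> avoids (circle c rho :: nil) z.
Proof.
intros hrho hz p [<-|[]] r _ h; apply hz; rewrite <- h; now apply circle_dist.
Qed.

Lemma is_cint_inv_center (c : C) (rho : R) :
  (0 < rho)%R -> is_cint (fun z => / (z - c)) (circle c rho :: nil) (2 * PI * Ci).
Proof.
intros hrho; exists (2 * PI * Ci), (RtoC 0); split; [|split; [reflexivity|ring]].
apply (is_RInt_ext (V := VC) (fun _ => 2 * PI * Ci)).
- intros r _; rewrite circle_velE.
  assert (h0 : circle c rho r - c <> 0).
    intros h; pose proof (circle_dist c rho r hrho) as hd; rewrite h, Cmod_0 in hd; lra.
  change (@eq C (2 * PI * Ci) (/ (circle c rho r - c) * (2 * PI * Ci * (circle c rho r - c)))).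
  field; exact h0.
- evar_last; [apply (is_RInt_const (V := VC) 0 1 (2 * PI * Ci))|].
  unfold scal; simpl; unfold prod_scal, scal; simpl; unfold mult; simpl.
  unfold Cmult; simpl; f_equal; ring.
Qed.

Lemma Cmod_sub_lower (a b c : C) : (Rabs (Cmod (a - c) - Cmod (b - c)) <= Cmod (b - a))%R.
Proof.
assert (h1 : (Cmod (a - c) <= Cmod (b - c) + Cmod (b - a))%R).
  replace (a - c) with ((b - c) + - (b - a)) by ring.
  eapply Rle_trans; [apply Cmod_triangle|]; rewrite Cmod_opp; lra.
assert (h2 : (Cmod (b - c) <= Cmod (a - c) + Cmod (b - a))%R).
  replace (b - c) with ((a - c) + (b - a)) by ring; apply Cmod_triangle.
apply Rabs_le; lra.
Qed.

Lemma circle_inv_bound (c z w : C) (rho : R) :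
  Cmod (w - c) <> rho -> Cmod (z - c) = rho ->
  (Cmod (/ (z - w)) <= / Rabs (Cmod (w - c) - rho))%R.
Proof.
intros hw hz.
assert (h0 : (0 < Rabs (Cmod (w - c) - rho))%R) by (apply Rabs_pos_lt; lra).
pose proof (Cmod_sub_lower w z c) as h1; rewrite hz in h1.
rewrite Cmod_inv; [now apply Rinv_le_contravar|].
intros h; rewrite h, Cmod_0 in h1; lra.
Qed.

Lemma Cmod_zero_of_geometric (w : C) (M th : R) :
  (0 < th < 1)%R -> (forall n : nat, (Cmod w <= M * th ^ n)%R) -> w = 0.
Proof.
intros hth h; apply Cmod_eq_0, Rle_antisym; [|apply Cmod_ge_0].
apply Rnot_lt_le; intros hw.
destruct (Rpow_small th hth M _ hw) as [N hN].
specialize (hN N (le_n N)); specialize (h N); lra.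
Qed.

Lemma circle_neq (c z w : C) (rho : R) :
  Cmod (w - c) <> rho -> Cmod (z - c) = rho -> z - w <> 0.
Proof. intros hw hz; apply Cminus_eq_contra; intros ->; contradiction. Qed.

Lemma winding_of_cint (g : list path) (z w : C) :
  is_cint (fun x => / (x - z)) g w -> winding g z = / (2 * PI * Ci) * w.
Proof. intros h; unfold winding; now rewrite (is_cint_unique _ _ _ h). Qed.

(** Writing (z - c)^(n+1) = (z - c)^n (z - w) + (w - c)(z - c)^n shows that the
    integral of (z - c)^n / (z - w) is (w - c)^n J, where J is the integral of
    1/(z - w).  It is O(rho^n), and rho < |w - c|, so J = 0. *)
Lemma winding_circle_outside (c w : C) (rho : R) :
  (0 < rho)%R -> (rho < Cmod (w - c))%R -> winding (circle c rho :: nil) w = 0.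
Proof.
intros hrho hw; set (g := circle c rho :: nil).
assert (hw' : Cmod (w - c) <> rho) by lra.
assert (h0 := is_cint_winding g w (circle_avoids c rho w hrho hw')).
set (J := 2 * PI * Ci * winding g w) in h0.
assert (hn : forall n, is_cint (fun z => (z - c) ^ n * / (z - w)) g ((w - c) ^ n * J)).
  induction n as [|n IH].
    replace ((w - c) ^ 0 * J) with J by (simpl; ring).
    apply is_cint_ext with (2 := h0); intros p _ r _; simpl; ring.
  replace ((w - c) ^ S n * J) with (0 + (w - c) * ((w - c) ^ n * J)) by (simpl; ring).
  apply (is_cint_ext (fun z => (z - c) ^ n + (w - c) * ((z - c) ^ n * / (z - w)))).
    intros p [<-|[]] r _; simpl Cpow; field.
    now apply (circle_neq c _ w rho), circle_dist.
  apply is_cint_plus; [apply cycle_pow, circle_cycle|now apply is_cint_scal].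
assert (hJ : J = 0).
  apply (Cmod_zero_of_geometric J (2 * PI * rho * / Rabs (Cmod (w - c) - rho))
    (rho / Cmod (w - c))).
    split; [apply Rdiv_lt_0_compat; lra|].
    apply Rmult_lt_reg_r with (Cmod (w - c)); [lra|].
    unfold Rdiv; rewrite Rmult_assoc, Rinv_l; lra.
  intros n.
  assert (hb := circle_bound c rho (rho ^ n * / Rabs (Cmod (w - c) - rho))
    (fun z => (z - c) ^ n * / (z - w)) ((w - c) ^ n * J) hrho).
  rewrite !Cmod_mult, Cmod_pow in hb.
  assert (hpos : (0 < Cmod (w - c) ^ n)%R) by (apply pow_lt; lra).
  unfold Rdiv; rewrite Rpow_mult_distr, pow_inv.
  apply Rmult_le_reg_l with (1 := hpos).
  replace (Cmod (w - c) ^ n * (2 * PI * rho * / Rabs (Cmod (w - c) - rho) *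
     (rho ^ n * / Cmod (w - c) ^ n)))%R
    with (2 * PI * rho * (rho ^ n * / Rabs (Cmod (w - c) - rho)))%R.
    apply hb; [|apply hn].
    intros z hz; rewrite Cmod_mult, Cmod_pow, hz.
    apply Rmult_le_compat_l; [apply pow_le; lra|now apply circle_inv_bound].
  field; split; [lra|].
  apply Rgt_not_eq, Rabs_pos_lt; lra.
replace (winding g w) with (/ (2 * PI * Ci) * J).
  rewrite hJ; ring.
unfold J; rewrite Cmult_assoc, Cinv_l, Cmult_1_l; [reflexivity|exact Ctwo_pi_i_neq_0].
Qed.

(** The same argument with negative powers: for w <> c the integral of
    1/((z - c)^n (z - w)) is (J - 2 pi i)/(w - c)^n for n > 0, and it is O(rho^-n);
    as |w - c| < rho, J = 2 pi i. *)
Lemma winding_circle_inside (c w : C) (rho : R) :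
  (0 < rho)%R -> (Cmod (w - c) < rho)%R -> winding (circle c rho :: nil) w = 1.
Proof.
intros hrho hw; set (g := circle c rho :: nil).
assert (hw' : Cmod (w - c) <> rho) by lra.
assert (h2 := is_cint_inv_center c rho hrho).
destruct (Ceq_dec w c) as [->|hwc].
  rewrite (winding_of_cint g c _ h2), Cinv_l; [reflexivity|exact Ctwo_pi_i_neq_0].
assert (hd0 : w - c <> 0) by now apply Cminus_eq_contra.
assert (hpos : (0 < Cmod (w - c))%R) by now apply Cmod_gt_0.
assert (h0 := is_cint_winding g w (circle_avoids c rho w hrho hw')).
set (J := 2 * PI * Ci * winding g w) in h0.
assert (hc : avoids g c).
  apply circle_avoids; [exact hrho|].
  replace (c - c) with (RtoC 0) by ring; rewrite Cmod_0; lra.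
assert (hzc : forall r, circle c rho r - c <> 0).
  intros r h; pose proof (circle_dist c rho r hrho) as hd; rewrite h, Cmod_0 in hd; lra.
assert (hzw : forall r, circle c rho r - w <> 0).
  intros r; now apply (circle_neq c _ w rho), circle_dist.
assert (hn : forall n, is_cint (fun z => / (z - c) ^ S n * / (z - w)) g
   (/ (w - c) ^ S n * (J - 2 * PI * Ci))).
  induction n as [|n IH].
    replace (/ (w - c) ^ 1 * (J - 2 * PI * Ci)) with
      (/ (w - c) * J + - / (w - c) * (2 * PI * Ci)) by (simpl; field; exact hd0).
    apply (is_cint_ext (fun z => / (w - c) * / (z - w) + - / (w - c) * / (z - c))).
      intros p [<-|[]] r _; simpl Cpow; field; auto.
    apply is_cint_plus; now apply is_cint_scal.
  replace (/ (w - c) ^ S (S n) * (J - 2 * PI * Ci)) with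
    (/ (w - c) * (/ (w - c) ^ S n * (J - 2 * PI * Ci)) + - / (w - c) * 0).
  2: { simpl Cpow; field; split; [now apply Cpow_nz|exact hd0]. }
  apply (is_cint_ext (fun z => / (w - c) * (/ (z - c) ^ S n * / (z - w)) +
     - / (w - c) * / (z - c) ^ S (S n))).
    intros p [<-|[]] r _; simpl Cpow; field; repeat split; auto using Cpow_nz.
  apply is_cint_plus; apply is_cint_scal; [exact IH|].
  apply cycle_inv_pow; [apply circle_cycle|exact hc].
assert (hJ : J - 2 * PI * Ci = 0).
  apply (Cmod_zero_of_geometric _ (2 * PI * rho * / Rabs (Cmod (w - c) - rho) *
    (Cmod (w - c) / rho)) (Cmod (w - c) / rho)).
    split; [apply Rdiv_lt_0_compat; lra|].
    apply Rmult_lt_reg_r with rho; [lra|].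
    unfold Rdiv; rewrite Rmult_assoc, Rinv_l; lra.
  intros n.
  assert (hb := circle_bound c rho (/ rho ^ S n * / Rabs (Cmod (w - c) - rho))
    (fun z => / (z - c) ^ S n * / (z - w)) (/ (w - c) ^ S n * (J - 2 * PI * Ci)) hrho).
  rewrite Cmod_mult, Cmod_inv, Cmod_pow in hb by now apply Cpow_nz.
  assert (hp1 : (0 < Cmod (w - c) ^ S n)%R) by (apply pow_lt; lra).
  apply Rmult_le_reg_l with (/ Cmod (w - c) ^ S n)%R; [now apply Rinv_0_lt_compat|].
  replace (/ Cmod (w - c) ^ S n * (2 * PI * rho * / Rabs (Cmod (w - c) - rho) *
      (Cmod (w - c) / rho) * (Cmod (w - c) / rho) ^ n))%R
    with (2 * PI * rho * (/ rho ^ S n * / Rabs (Cmod (w - c) - rho)))%R.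
    apply hb; [|apply hn].
    intros z hz; assert (hz0 : z - c <> 0).
      intros h; rewrite h, Cmod_0 in hz; lra.
    rewrite Cmod_mult, Cmod_inv, Cmod_pow, hz by now apply Cpow_nz.
    apply Rmult_le_compat_l; [apply Rlt_le, Rinv_0_lt_compat, pow_lt; lra|].
    now apply circle_inv_bound.
  unfold Rdiv; rewrite Rpow_mult_distr, pow_inv; simpl; field.
  repeat split; try lra; try (apply pow_nonzero; lra).
  apply Rgt_not_eq, Rabs_pos_lt; lra.
replace (winding g w) with (/ (2 * PI * Ci) * (J - 2 * PI * Ci) + 1).
  rewrite hJ; ring.
unfold J; replace (/ (2 * PI * Ci) * (2 * PI * Ci * winding g w - 2 * PI * Ci) + 1)
  with (/ (2 * PI * Ci) * (2 * PI * Ci) * (winding g w - 1) + 1) by ring.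
rewrite Cinv_l; [ring|exact Ctwo_pi_i_neq_0].
Qed.

Lemma winding_cons (p : path) (g : list path) (z : C) :
  winding (p :: g) z = winding (p :: nil) z + winding g z.
Proof. unfold winding, contour_integral; simpl; ring. Qed.

Lemma avoids_cons (p : path) (g : list path) (z : C) :
  avoids (p :: nil) z -> avoids g z -> avoids (p :: g) z.
Proof. intros h1 h2 p' [<-|hp']; [apply h1; now left|now apply h2]. Qed.

(** * Existence of a contour *)

Definition separated (c : C) (W : C -> Prop) : Prop :=
  exists rho : R, (0 < rho)%R /\ forall w, W w -> w <> c -> (rho < Cmod (w - c))%R.

Lemma separated_or (c : C) (W W' : C -> Prop) :
  separated c W -> separated c W' -> separated c (fun w => W w \/ W' w).
Proof.
intros (r & hr & h) (r' & hr' & h'); exists (Rmin r r'); split; [now apply Rmin_glb_lt|].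
intros w [hw|hw] hwc.
  apply Rle_lt_trans with (1 := Rmin_l r r'); auto.
apply Rle_lt_trans with (1 := Rmin_r r r'); auto.
Qed.

Lemma separated_eq (c d : C) : separated c (fun w => w = d).
Proof.
destruct (Ceq_dec d c) as [->|h].
  exists 1%R; split; [lra|]; now intros w ->.
assert (hp : (0 < Cmod (d - c))%R) by now apply Cmod_gt_0, Cminus_eq_contra.
exists (Cmod (d - c) / 2)%R; split; [lra|]; intros w -> _; lra.
Qed.

Lemma separated_seq (c : C) (a : nat -> C) (delta : R) (N : nat) :
  (0 < delta)%R -> (forall n, (N <= n)%nat -> (delta < Cmod (a n - c))%R) ->
  separated c (fun w => exists n, w = a n).
Proof.
intros hd h.
assert (hN : forall M, separated c (fun w => exists n, (n < M)%nat /\ w = a n)).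
  induction M as [|M IH].
    exists 1%R; split; [lra|]; intros w (n & hn & _); lia.
  destruct (separated_or c _ _ IH (separated_eq c (a M))) as (r & hr & hrw).
  exists r; split; [exact hr|]; intros w (n & hn & hw); apply hrw.
  destruct (Nat.eq_dec n M) as [->|hnM]; [now right|left; exists n; split; [lia|exact hw]].
destruct (hN N) as (r & hr & hrw).
exists (Rmin r delta); split; [now apply Rmin_glb_lt|].
intros w (n & ->) hw; destruct (Nat.lt_ge_cases n N) as [hn|hn].
  apply Rle_lt_trans with (1 := Rmin_l r delta), hrw; [now exists n|exact hw].
apply Rle_lt_trans with (1 := Rmin_r r delta); auto.
Qed.

Lemma separated_list (c : C) (T : Type) (l : list T) (W : T -> C -> Prop) :
  (forall a, In a l -> separated c (W a)) ->
  separated c (fun w => exists a, In a l /\ W a w).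
Proof.
induction l as [|a l IH]; intros h.
  exists 1%R; split; [lra|]; now intros w (a & [] & _).
destruct (separated_or c _ _ (h a (or_introl eq_refl)) (IH (fun b hb => h b (or_intror hb))))
  as (r & hr & hrw).
exists r; split; [exact hr|]; intros w (b & [<-|hb] & hw); apply hrw; [now left|].
right; now exists b.
Qed.

Lemma separated_geometric (P : R) (hP : (0 < P < 1)%R) (c i : C) :
  c <> 0 -> separated c (fun w => exists k, w = i * RtoC P ^ k).
Proof.
intros hc; assert (hc0 : (0 < Cmod c)%R) by now apply Cmod_gt_0.
destruct (Rpow_small P hP (Cmod i) (Cmod c / 2)) as [N hN]; [lra|].
apply separated_seq with (delta := (Cmod c / 2)%R) (N := N); [lra|].
intros n hn; specialize (hN n hn).
assert (h : Cmod (i * RtoC P ^ n) = (Cmod i * P ^ n)%R).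
  now rewrite Cmod_mult, Cmod_RtoC_pow by lra.
assert (Cmod c <= Cmod (i * RtoC P ^ n) + Cmod (i * RtoC P ^ n - c))%R; [|lra].
replace c with ((i * RtoC P ^ n) + - (i * RtoC P ^ n - c)) at 1 by ring.
eapply Rle_trans; [apply Cmod_triangle|]; rewrite Cmod_opp; lra.
Qed.

Lemma Cmod_div_pow (P : R) (hP : (0 < P < 1)%R) (o : C) (m : nat) :
  Cmod (o / RtoC P ^ m) = (Cmod o / P ^ m)%R.
Proof.
unfold Cdiv; rewrite Cmod_mult, Cmod_inv; [rewrite Cmod_RtoC_pow by lra; reflexivity|].
apply Cpow_nz, RtoC_neq_0; lra.
Qed.

Lemma Rdiv_pow_ge (P : R) (hP : (0 < P < 1)%R) (a : R) (m : nat) :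
  (0 <= a)%R -> (a <= a / P ^ m)%R.
Proof.
intros ha; assert (h : (0 < P ^ m)%R) by (apply pow_lt; lra).
assert (h1 : (P ^ m <= 1)%R) by (rewrite <- (pow1 m); apply pow_incr; lra).
apply Rmult_le_reg_r with (1 := h); unfold Rdiv.
rewrite Rmult_assoc, Rinv_l by lra; nra.
Qed.

Lemma separated_geometric_inv (P : R) (hP : (0 < P < 1)%R) (c o : C) :
  o <> 0 -> separated c (fun w => exists m, w = o / RtoC P ^ m).
Proof.
intros ho; assert (ho0 : (0 < Cmod o)%R) by now apply Cmod_gt_0.
destruct (Rpow_small P hP (Cmod c + 1) (Cmod o) ho0) as [N hN].
apply separated_seq with (delta := (1 / 2)%R) (N := N); [lra|].
intros n hn; specialize (hN n hn).
assert (hp : (0 < P ^ n)%R) by (apply pow_lt; lra).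
assert (h : (Cmod c + 1 < Cmod (o / RtoC P ^ n))%R).
  rewrite Cmod_div_pow by exact hP.
  apply Rmult_lt_reg_r with (1 := hp); unfold Rdiv.
  rewrite (Rmult_assoc (Cmod o)), Rinv_l, Rmult_1_r by lra; exact hN.
assert (Cmod (o / RtoC P ^ n) <= Cmod c + Cmod (o / RtoC P ^ n - c))%R; [|lra].
replace (o / RtoC P ^ n) with (c + (o / RtoC P ^ n - c)) at 1 by ring.
apply Cmod_triangle.
Qed.

(** Bisecting for each entry keeps an open interval free of the list. *)
Lemma exists_radius (l : list R) (a b : R) :
  (a < b)%R -> exists r, (a < r < b)%R /\ ~ In r l.
Proof.
intros hab.
enough (H : exists a' b', (a <= a' < b')%R /\ (b' <= b)%R /\
    forall x, In x l -> ~ (a' < x < b')%R).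
  destruct H as (a' & b' & h1 & h2 & h); exists ((a' + b') / 2)%R; split; [lra|].
  intros hx; apply (h _ hx); lra.
induction l as [|x l (a' & b' & h1 & h2 & h)].
  exists a, b; repeat split; try lra; intros x [].
destruct (Rle_lt_dec x ((a' + b') / 2)).
- exists ((a' + b') / 2)%R, b'; repeat split; try lra.
  intros y [<-|hy] hy'; [lra|apply (h y hy); lra].
- exists a', ((a' + b') / 2)%R; repeat split; try lra.
  intros y [<-|hy] hy'; [lra|apply (h y hy); lra].
Qed.

(** Each point of [l] gets a circle too small to meet or enclose another point of
    [W]; as [l] has no repetition, every such point is enclosed exactly once. *)
Lemma small_circles (W : C -> Prop) (l : list C) :
  NoDup l -> (forall c, In c l -> W c /\ separated c W) ->
  exists g, cycle g /\ forall w, W w ->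
    avoids g w /\ (In w l -> winding g w = 1) /\ (~ In w l -> winding g w = 0).
Proof.
induction 1 as [|c l hc _ IH]; intros hW.
  exists nil; split; [intros F f _; reflexivity|].
  intros w _; split; [now intros p []|split; [now intros []|]].
  intros _; unfold winding, contour_integral; simpl; ring.
destruct IH as (g & hg & hgw); [intros d hd; apply hW; now right|].
destruct (hW c (or_introl eq_refl)) as (hWc & rho & hrho & hsep).
exists (circle c rho :: g); split.
  exact (cycle_app _ _ (circle_cycle c rho) hg).
intros w hw; destruct (hgw w hw) as (h1 & h2 & h3).
rewrite winding_cons; destruct (Ceq_dec w c) as [->|hwc].
- assert (hd : (Cmod (c - c) < rho)%R).
    replace (c - c) with (RtoC 0) by ring; now rewrite Cmod_0.
  split; [apply avoids_cons; [apply circle_avoids; lra|exact h1]|].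
  rewrite winding_circle_inside by assumption.
  split; [intros _; rewrite (h3 hc); ring|intros h; exfalso; apply h; now left].
- specialize (hsep w hw hwc).
  split; [apply avoids_cons; [apply circle_avoids; lra|exact h1]|].
  rewrite winding_circle_outside by assumption.
  split; [intros [<-|h]; [congruence|rewrite (h2 h); ring]|].
  intros h; rewrite h3; [ring|]; intros h'; apply h; now right.
Qed.

Lemma lower_bound_list (l : list C) :
  (forall o, In o l -> o <> 0) ->
  exists r : R, (0 < r)%R /\ forall o, In o l -> (r < Cmod o)%R.
Proof.
intros h.
destruct (separated_list 0 C l (fun o w => w = o)) as (r & hr & hrw).
  intros o _; apply separated_eq.
exists r; split; [exact hr|]; intros o ho.
replace o with (o - 0) by ring; apply hrw; [now exists o|now apply h].
Qed.

(** The part of the requirements on a contour that determines integrals: the inner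
    poles form progressions i P^k tending to 0, the outer ones progressions o / P^m
    tending to infinity. *)
Definition encloses (P : R) (ins outs : list C) (g : list path) : Prop :=
  cycle g /\ inside g 0 /\
  (forall i, In i ins -> forall k, inside g (i * RtoC P ^ k)) /\
  (forall o, In o outs -> forall m, outside g (o / RtoC P ^ m)).

(** A circle about 0 that is smaller than all outer points encloses all but
    finitely many inner points; small circles are added about the others. *)
Theorem contour_exists (P : R) (hP : (0 < P < 1)%R) (ins outs : list C) :
  (forall o, In o outs -> o <> 0) ->
  (forall i o, In i ins -> In o outs -> forall k m, i * RtoC P ^ k <> o / RtoC P ^ m) ->
  exists g, encloses P ins outs g.
Proof.
intros hout hdisj.
destruct (lower_bound_list outs hout) as (r0 & hr0 & hro).
assert (hN : exists N, forall i, In i ins -> forall k, (N <= k)%nat ->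
    (Cmod (i * RtoC P ^ k) < r0 / 2)%R).
  clear hdisj; induction ins as [|i ins [N IH]]; [exists O; intros i []|].
  destruct (Rpow_small P hP (Cmod i) (r0 / 2)) as [N' hN']; [lra|].
  exists (Nat.max N N'); intros j [<-|hj] k hk.
    rewrite Cmod_mult, Cmod_RtoC_pow by lra; apply hN'; lia.
  apply IH; [exact hj|lia].
destruct hN as [N hN].
set (L := flat_map (fun i => map (fun k => i * RtoC P ^ k) (seq 0 N)) ins).
assert (hL : forall w, In w L <-> exists i k, In i ins /\ (k < N)%nat /\ w = i * RtoC P ^ k).
  intros w; unfold L; rewrite in_flat_map; split.
  - intros (i & hi & hw); apply in_map_iff in hw; destruct hw as (k & <- & hk).
    apply in_seq in hk; exists i, k; repeat split; [exact hi|lia].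
  - intros (i & k & hi & hk & ->); exists i; split; [exact hi|].
    apply in_map_iff; exists k; split; [reflexivity|apply in_seq; lia].
destruct (exists_radius (map Cmod L) (r0 / 2) r0) as (r & hr & hrL); [lra|].
set (big := nodup Ceq_dec
  (filter (fun w => if Rlt_dec r (Cmod w) then true else false) L)).
assert (hbig : forall w, In w big <-> In w L /\ (r < Cmod w)%R).
  intros w; unfold big; rewrite nodup_In, filter_In.
  destruct (Rlt_dec r (Cmod w)); intuition discriminate.
set (W := fun w : C => (w = 0 \/ exists i, In i ins /\ exists k, w = i * RtoC P ^ k) \/
  exists o, In o outs /\ exists m, w = o / RtoC P ^ m).
assert (hin : forall i k, In i ins -> Cmod (i * RtoC P ^ k) <> r).
  intros i k hi; destruct (Nat.lt_ge_cases k N) as [hk|hk].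
    intros h; apply hrL; rewrite <- h; apply in_map, hL; now exists i, k.
  pose proof (hN i hi k hk); lra.
assert (hoR : forall o m, In o outs -> (r < Cmod (o / RtoC P ^ m))%R).
  intros o m ho; rewrite Cmod_div_pow by exact hP.
  pose proof (Rdiv_pow_ge P hP (Cmod o) m (Cmod_ge_0 o)); pose proof (hro o ho); lra.
destruct (small_circles W big) as (g & hg & hgw).
- apply NoDup_nodup.
- intros c hc; apply hbig in hc; destruct hc as [hc hcr].
  assert (hc0 : c <> 0) by (intros ->; rewrite Cmod_0 in hcr; lra).
  apply hL in hc; destruct hc as (i & k & hi & _ & hck).
  split; [left; right; exists i; split; [exact hi|now exists k]|].
  apply separated_or; [apply separated_or|].
  + apply separated_eq.
  + apply (separated_list c C ins (fun i w => exists k, w = i * RtoC P ^ k)).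
    intros j _; now apply separated_geometric.
  + apply (separated_list c C outs (fun o w => exists m, w = o / RtoC P ^ m)).
    intros o ho; now apply separated_geometric_inv, hout.
- exists (circle 0 r :: g).
  assert (hm0 : forall w : C, w - 0 = w) by (intros w; ring).
  assert (hsmall : forall w, W w -> (Cmod w < r)%R -> inside (circle 0 r :: g) w).
    intros w hw hwr; destruct (hgw w hw) as (h1 & _ & h3).
    split.
      apply avoids_cons; [apply circle_avoids; rewrite ?hm0; lra|exact h1].
    rewrite winding_cons, winding_circle_inside, h3; rewrite ?hm0; try lra; [ring|].
    intros hb; apply hbig in hb; lra.
  split; [exact (cycle_app _ _ (circle_cycle 0 r) hg)|].
  split; [|split].
  + apply hsmall; [now left; left|rewrite Cmod_0; lra].
  + intros i hi k.
    assert (hw : W (i * RtoC P ^ k)) by (left; right; exists i; split; [exact hi|now exists k]).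
    destruct (Rtotal_order (Cmod (i * RtoC P ^ k)) r) as [h|[h|h]].
    * now apply hsmall.
    * exfalso; exact (hin i k hi h).
    * destruct (hgw _ hw) as (h1 & h2 & _); split.
        apply avoids_cons; [apply circle_avoids; rewrite ?hm0; lra|exact h1].
      rewrite winding_cons, winding_circle_outside, h2; rewrite ?hm0; try lra; [ring|].
      apply hbig; split; [|exact h]; apply hL; exists i, k; repeat split; [exact hi|].
      apply Nat.nle_gt; intros hk; pose proof (hN i hi k hk); lra.
  + intros o ho m.
    assert (hw : W (o / RtoC P ^ m)) by (right; exists o; split; [exact ho|now exists m]).
    pose proof (hoR o m ho) as h.
    destruct (hgw _ hw) as (h1 & _ & h3); split.
      apply avoids_cons; [apply circle_avoids; rewrite ?hm0; lra|exact h1].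
    rewrite winding_cons, winding_circle_outside, h3; rewrite ?hm0; try lra; [ring|].
    intros hb; apply hbig in hb; destruct hb as [hb _]; apply hL in hb.
    destruct hb as (i & k & hi & _ & hik); apply (hdisj i o hi ho k m); now symmetry.
Qed.

(** * Dilations *)

Lemma dilate_pos (k : C) (p : path) (r : R) :
  is_derive (K := R_AbsRing) (V := VC) (fun x => k * p x) r (k * vel p r).
Proof.
evar_last; [apply (is_derive_Cmult _ _ _ _ _ (is_derive_Cconst k r) (pos_derive p r))|].
as_C; ring.
Qed.

Lemma dilate_vel (k : C) (p : path) (r : R) :
  continuous (T := R_UniformSpace) (U := C_UniformSpace) (fun x => k * vel p x) r.
Proof.
apply (tendsto_continuous (fun x => k * vel p x)).
exact (tendsto_mult _ _ _ _ _ (tendsto_const _ k) (vel_tendsto p r)).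
Qed.

Definition dilate (k : C) (p : path) : path :=
  Path (fun x => k * p x) (fun x => k * vel p x) (dilate_pos k p) (dilate_vel k p).

Lemma is_cint_dilate (k : C) (f : C -> C) (g : list path) (w : C) :
  is_cint (fun z => k * f (k * z)) g w <-> is_cint f (map (dilate k) g) w.
Proof.
revert w; induction g as [|p g IH]; intros w; [easy|].
assert (hp : forall a, is_pint (fun z => k * f (k * z)) p a <-> is_pint f (dilate k p) a).
  intros a; split; apply is_RInt_ext; intros r _; simpl; as_C; ring.
split; intros (a & b & ha & hb & ->); exists a, b; (split; [now apply hp|]);
  (split; [now apply IH|reflexivity]).
Qed.

Lemma cycle_dilate (k : C) (g : list path) : cycle g -> cycle (map (dilate k) g).
Proof.
intros hg F f h; apply is_cint_dilate.
apply (hg (fun z => F (k * z))); intros p hp r hr.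
destruct (h (dilate k p) (in_map _ _ _ hp) r hr) as [h1 h2]; split.
  evar_last; [exact h1|simpl; as_C; ring].
simpl in h2.
replace (k * f (k * p r) * vel p r) with (f (k * p r) * (k * vel p r)) by ring.
refine (tendsto_ext _ _ _ _ _ h2).
apply filter_forall; intros x; ring.
Qed.

Lemma avoids_dilate (k : C) (g : list path) (z : C) :
  k <> 0 -> avoids g (z / k) -> avoids (map (dilate k) g) z.
Proof.
intros hk h p' hp' r hr; apply in_map_iff in hp'; destruct hp' as (p & <- & hp).
intros hz; apply (h p hp r hr); rewrite <- hz; simpl; field; exact hk.
Qed.

Lemma winding_dilate (k : C) (g : list path) (z : C) :
  k <> 0 -> avoids g (z / k) -> winding (map (dilate k) g) z = winding g (z / k).
Proof.
intros hk h.
assert (h1 := is_cint_winding g (z / k) h).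
rewrite (winding_of_cint _ z (2 * PI * Ci * winding g (z / k))).
  rewrite Cmult_assoc, Cinv_l, Cmult_1_l; [reflexivity|exact Ctwo_pi_i_neq_0].
apply is_cint_dilate, is_cint_ext with (2 := h1).
intros p hp r hr.
assert (h0 : p r - z / k <> 0) by (apply Cminus_eq_contra; now apply h).
assert (h0' : k * p r - z <> 0).
  replace (k * p r - z) with (k * (p r - z / k)) by (field; exact hk).
  now apply Cmult_neq_0.
field; repeat split; assumption.
Qed.
(** * Contours and progressions of poles *)

(** A progression may be replaced by one of its tails. *)
Lemma encloses_sub (P : R) (ins outs ins' outs' : list C) (g : list path) :
  (0 < P)%R ->
  encloses P ins outs g ->
  (forall i', In i' ins' -> exists i j, In i ins /\ i' = i * RtoC P ^ j) ->
  (forall o', In o' outs' -> exists o j, In o outs /\ o' = o / RtoC P ^ j) ->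
  encloses P ins' outs' g.
Proof.
intros hP (hg & h0 & hi & ho) hi' ho'; split; [exact hg|split; [exact h0|split]].
- intros i' hin k; destruct (hi' i' hin) as (i & j & hii & ->).
  replace (i * RtoC P ^ j * RtoC P ^ k) with (i * RtoC P ^ (j + k))
    by (rewrite Cpow_add_r; ring).
  now apply hi.
- intros o' hin m; destruct (ho' o' hin) as (o & j & hoo & ->).
  replace (o / RtoC P ^ j / RtoC P ^ m) with (o / RtoC P ^ (j + m)).
    now apply ho.
  assert (hP0 : RtoC P <> 0) by now apply RtoC_neq_0.
  rewrite Cpow_add_r; field; split; now apply Cpow_nz.
Qed.

Lemma encloses_dilate (P : R) (k : C) (ins outs : list C) (g : list path) :
  (0 < P)%R -> k <> 0 -> encloses P ins outs g ->
  encloses P (map (Cmult k) ins) (map (Cmult k) outs) (map (dilate k) g).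
Proof.
intros hP hk (hg & h0 & hi & ho).
assert (hP0 : RtoC P <> 0) by now apply RtoC_neq_0.
assert (hin : forall z, inside g z -> inside (map (dilate k) g) (k * z)).
  intros z; replace z with (k * z / k) at 1 by (field; exact hk).
  intros [h1 h2]; split; [now apply avoids_dilate|now rewrite winding_dilate].
assert (hout : forall z, outside g z -> outside (map (dilate k) g) (k * z)).
  intros z; replace z with (k * z / k) at 1 by (field; exact hk).
  intros [h1 h2]; split; [now apply avoids_dilate|now rewrite winding_dilate].
split; [now apply cycle_dilate|split; [|split]].
- replace (RtoC 0) with (k * 0) by ring; now apply hin.
- intros i hi' n; apply in_map_iff in hi'; destruct hi' as (j & <- & hj).
  rewrite <- Cmult_assoc; now apply hin, hi.
- intros o ho' n; apply in_map_iff in ho'; destruct ho' as (j & <- & hj).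
  replace (k * j / RtoC P ^ n) with (k * (j / RtoC P ^ n)) by (unfold Cdiv; ring).
  now apply hout, ho.
Qed.

Definition poles (P : R) (ins outs : list C) (z : C) : Prop :=
  z = 0 \/ (exists i, In i ins /\ exists k, z = i * RtoC P ^ k) \/
  (exists o, In o outs /\ exists m, z = o / RtoC P ^ m).

Lemma encloses_avoids (P : R) (ins outs : list C) (g : list path) :
  encloses P ins outs g -> avoids_set g (poles P ins outs).
Proof.
intros (_ & h0 & hi & ho) z [->|[(i & hin & k & ->)|(o & hin & m & ->)]].
- apply h0.
- now apply hi.
- now apply ho.
Qed.

Lemma encloses_same_integral (P : R) (ins outs : list C) (g1 g2 : list path) (f : C -> C) :
  encloses P ins outs g1 -> encloses P ins outs g2 ->
  rational_limit (poles P ins outs) f -> same_integral g1 g2 f.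
Proof.
intros h1 h2 hf.
apply (cauchy_homology g1 g2 (poles P ins outs)); try apply h1; try apply h2;
  try (eapply encloses_avoids; eassumption); [|exact hf].
destruct h1 as (_ & h0 & hi & ho), h2 as (_ & h0' & hi' & ho').
intros z [->|[(i & hin & k & ->)|(o & hin & m & ->)]].
- rewrite (proj2 h0); now rewrite (proj2 h0').
- rewrite (proj2 (hi i hin k)); now rewrite (proj2 (hi' i hin k)).
- rewrite (proj2 (ho o hin m)); now rewrite (proj2 (ho' o hin m)).
Qed.

(** * Quotients of infinite products as limits of rational functions *)

Lemma rational_limit_mult (Z : C -> Prop) (f f' : C -> C) :
  rational_limit Z f -> rational_limit Z f' -> rational_limit Z (fun z => f z * f' z).
Proof.
intros (fn & h1 & h2) (fn' & h1' & h2'); exists (fun n z => fn n z * fn' n z); split.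
  intros n; now apply rational_mult.
intros z hz; apply (tendsto_mult _ (fun nz => fn (fst nz) (snd nz))
  (fun nz => fn' (fst nz) (snd nz))); [now apply h2|now apply h2'].
Qed.

Lemma rational_limit_ext (Z : C -> Prop) (f f' : C -> C) :
  (forall z, ~ Z z -> f z = f' z) -> rational_limit Z f -> rational_limit Z f'.
Proof.
intros h (fn & h1 & h2); exists fn; split; [exact h1|].
intros z hz; rewrite <- h by exact hz; now apply h2.
Qed.

Lemma rational_qpoch_mul (Z : C -> Prop) (c : C) (P : R) (n : nat) :
  rational Z (fun z => qpoch_fin (c * z) P n).
Proof.
induction n as [|n IH]; simpl; [constructor|].
apply rational_ext with (f := fun z => qpoch_fin (c * z) P n +
   (- c * RtoC P ^ n) * (z * qpoch_fin (c * z) P n)); [intros z _; ring|].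
apply rational_plus; [exact IH|now apply rational_scal, rational_mul].
Qed.

Lemma rational_qpoch_div (Z : C -> Prop) (c : C) (P : R) (n : nat) :
  Z 0 -> rational Z (fun z => qpoch_fin (c / z) P n).
Proof.
intros h0; induction n as [|n IH]; simpl; [constructor|].
apply rational_ext with (f := fun z => qpoch_fin (c / z) P n +
   (- c * RtoC P ^ n) * (/ (z - 0) * qpoch_fin (c / z) P n)).
  intros z _; replace (z - 0) with z by ring; unfold Cdiv; ring.
apply rational_plus; [exact IH|now apply rational_scal, rational_div].
Qed.

Lemma tendsto_scale (c z : C) :
  tendsto (locally (T := C_UniformSpace) z) (fun w => c * w) (c * z).
Proof. apply (tendsto_mult _ _ _ _ _ (tendsto_const _ c) (tendsto_id z)). Qed.

Lemma tendsto_div (c z : C) :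
  z <> 0 -> tendsto (locally (T := C_UniformSpace) z) (fun w => c / w) (c / z).
Proof.
intros hz.
apply (tendsto_mult _ _ _ _ _ (tendsto_const _ c) (tendsto_inv _ _ _ hz (tendsto_id z))).
Qed.

Lemma rational_limit_qpoch_mul (P : R) (hP : (0 < P < 1)%R) (Z : C -> Prop) (c : C) :
  rational_limit Z (fun z => qpoch (c * z) P).
Proof.
exists (fun n z => qpoch_fin (c * z) P n); split; [intros n; apply rational_qpoch_mul|].
intros z _; apply (cconv_comp (fun n w => qpoch_fin w P n) (fun w => c * w)).
  apply tendsto_scale.
now apply cconv_qpoch.
Qed.

Lemma rational_limit_qpoch_div (P : R) (hP : (0 < P < 1)%R) (Z : C -> Prop) (c : C) :
  Z 0 -> rational_limit Z (fun z => qpoch (c / z) P).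
Proof.
intros h0.
exists (fun n z => qpoch_fin (c / z) P n); split; [intros n; now apply rational_qpoch_div|].
intros z hz; apply (cconv_comp (fun n w => qpoch_fin w P n) (fun w => c / w)).
  apply tendsto_div; now intros ->.
now apply cconv_qpoch.
Qed.

Lemma qpoch_mul_factor (P : R) (hP : (0 < P)%R) (c z : C) (k : nat) :
  c <> 0 -> z <> / c / RtoC P ^ k -> 1 - c * z * RtoC P ^ k <> 0.
Proof.
intros hc hz; apply Cminus_eq_contra; intros h; apply hz.
assert (hk : RtoC P ^ k <> 0) by now apply Cpow_nz, RtoC_neq_0.
replace (/ c / RtoC P ^ k) with (1 / (c * RtoC P ^ k)) by (field; auto).
rewrite h; field; auto.
Qed.

Lemma qpoch_div_factor (P : R) (c z : C) (k : nat) :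
  z <> 0 -> z <> c * RtoC P ^ k -> 1 - c / z * RtoC P ^ k <> 0.
Proof.
intros hz0 hz; apply Cminus_eq_contra; intros h; apply hz.
transitivity (z * 1); [ring|rewrite h; field; exact hz0].
Qed.

Lemma qpoch_fin_neq_0 (P : R) (x : C) (n : nat) :
  (forall k, 1 - x * RtoC P ^ k <> 0) -> qpoch_fin x P n <> 0.
Proof.
intros h; induction n as [|n IH]; simpl; [exact C1_nz|now apply Cmult_neq_0].
Qed.

Lemma rational_inv_qpoch_mul (P : R) (hP : (0 < P)%R) (Z : C -> Prop) (c : C) (n : nat) :
  c <> 0 -> (forall k, Z (/ c / RtoC P ^ k)) ->
  rational Z (fun z => / qpoch_fin (c * z) P n).
Proof.
intros hc hZ; induction n as [|n IH]; simpl.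
  apply rational_ext with (2 := rational_one Z); intros z _; field; exact C1_nz.
apply rational_ext with (2 := rational_scal _ (- / (c * RtoC P ^ n)) _
   (rational_div _ _ _ (hZ n) IH)).
intros z hz.
assert (hk : forall k, 1 - c * z * RtoC P ^ k <> 0).
  intros k; apply qpoch_mul_factor; auto; intros ->; exact (hz (hZ k)).
assert (hn : RtoC P ^ n <> 0) by now apply Cpow_nz, RtoC_neq_0.
replace (z - / c / RtoC P ^ n) with (- (1 - c * z * RtoC P ^ n) / (c * RtoC P ^ n))
  by (field; auto).
field; repeat split; auto using qpoch_fin_neq_0.
Qed.

Lemma rational_inv_qpoch_div (P : R) (Z : C -> Prop) (c : C) (n : nat) :
  Z 0 -> (forall k, Z (c * RtoC P ^ k)) ->
  rational Z (fun z => / qpoch_fin (c / z) P n).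
Proof.
intros h0 hZ; induction n as [|n IH]; simpl.
  apply rational_ext with (2 := rational_one Z); intros z _; field; exact C1_nz.
apply rational_ext with (2 := rational_mul _ _ (rational_div _ _ _ (hZ n) IH)).
intros z hz.
assert (hz0 : z <> 0) by now intros ->.
assert (hk : forall k, 1 - c / z * RtoC P ^ k <> 0).
  intros k; apply qpoch_div_factor; auto; intros h; apply hz; rewrite h; apply hZ.
replace (1 - c / z * RtoC P ^ n) with ((z - c * RtoC P ^ n) / z) by (field; exact hz0).
field; repeat split; auto using qpoch_fin_neq_0.
apply Cminus_eq_contra; intros h; apply hz; rewrite h; apply hZ.
Qed.

Lemma rational_limit_inv_qpoch_mul (P : R) (hP : (0 < P < 1)%R) (Z : C -> Prop) (c : C) :
  c <> 0 -> (forall k, Z (/ c / RtoC P ^ k)) -> rational_limit Z (fun z => / qpoch (c * z) P).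
Proof.
intros hc hZ; exists (fun n z => / qpoch_fin (c * z) P n); split.
  intros n; apply rational_inv_qpoch_mul; auto; lra.
intros z hz; apply (tendsto_inv _ (fun nz => qpoch_fin (c * snd nz) P (fst nz))).
  apply qpoch_neq_0; [exact hP|]; intros k; apply qpoch_mul_factor; auto; [lra|].
  intros ->; exact (hz (hZ k)).
apply (cconv_comp (fun n w => qpoch_fin w P n) (fun w => c * w)).
  apply tendsto_scale.
now apply cconv_qpoch.
Qed.

Lemma rational_limit_inv_qpoch_div (P : R) (hP : (0 < P < 1)%R) (Z : C -> Prop) (c : C) :
  Z 0 -> (forall k, Z (c * RtoC P ^ k)) -> rational_limit Z (fun z => / qpoch (c / z) P).
Proof.
intros h0 hZ; exists (fun n z => / qpoch_fin (c / z) P n); split.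
  intros n; now apply rational_inv_qpoch_div.
intros z hz; assert (hz0 : z <> 0) by now intros ->.
apply (tendsto_inv _ (fun nz => qpoch_fin (c / snd nz) P (fst nz))).
  apply qpoch_neq_0; [exact hP|]; intros k; apply qpoch_div_factor; auto.
  intros h; apply hz; rewrite h; apply hZ.
apply (cconv_comp (fun n w => qpoch_fin w P n) (fun w => c / w)).
  now apply tendsto_div.
now apply cconv_qpoch.
Qed.

Lemma rational_limit_inv_id (Z : C -> Prop) : Z 0 -> rational_limit Z (fun z => / z).
Proof.
intros h0; exists (fun _ z => / z); split.
  intros _; apply rational_ext with (2 := rational_div _ 0 _ h0 (rational_one Z)).
  intros z _; replace (z - 0) with z by ring; ring.
intros z hz; apply cconv_snd; apply (tendsto_inv _ (fun w : C => w)); [now intros ->|].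
apply tendsto_id.
Qed.

(** The common form of the kernel and of its potential, with [n1], [n2] for the
    numerators, [h1], [h2] for the theta functions, [d1] to [d4] for the outer and
    [e1], [e2] for the inner poles. *)
Definition qpoch_quotient (P : R) (n1 n2 h1 h2 d1 d2 d3 d4 e1 e2 z : C) : C :=
  qpoch (n1 * z) P * qpoch (n2 * z) P * qtheta (h1 * z) P * qtheta (h2 * z) P /
  (qpoch (d1 * z) P * qpoch (d2 * z) P * qpoch (d3 * z) P * qpoch (d4 * z) P *
   qpoch (e1 / z) P * qpoch (e2 / z) P).

Lemma rational_limit_qtheta (P : R) (hP : (0 < P < 1)%R) (Z : C -> Prop) (h : C) :
  Z 0 -> rational_limit Z (fun z => qtheta (h * z) P).
Proof.
intros h0; unfold qtheta; apply rational_limit_mult; [now apply rational_limit_qpoch_mul|].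
apply (rational_limit_ext _ (fun z => qpoch (RtoC P / h / z) P));
  [|now apply rational_limit_qpoch_div].
intros z _; f_equal; unfold Cdiv; rewrite Cinv_mult'; ring.
Qed.

Lemma rational_limit_qpoch_quotient (P : R) (hP : (0 < P < 1)%R)
    (n1 n2 h1 h2 d1 d2 d3 d4 e1 e2 : C) :
  d1 <> 0 -> d2 <> 0 -> d3 <> 0 -> d4 <> 0 ->
  rational_limit (poles P (e1 :: e2 :: nil) (/ d1 :: / d2 :: / d3 :: / d4 :: nil))
    (qpoch_quotient P n1 n2 h1 h2 d1 d2 d3 d4 e1 e2).
Proof.
intros hd1 hd2 hd3 hd4.
set (Z := poles P (e1 :: e2 :: nil) (/ d1 :: / d2 :: / d3 :: / d4 :: nil)).
assert (h0 : Z 0) by now left.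
assert (hd : forall d, In (/ d) (/ d1 :: / d2 :: / d3 :: / d4 :: nil) -> d <> 0 ->
    rational_limit Z (fun z => / qpoch (d * z) P)).
  intros d hdin hdn; apply rational_limit_inv_qpoch_mul; auto.
  intros k; right; right; exists (/ d); split; [exact hdin|now exists k].
assert (he : forall e, In e (e1 :: e2 :: nil) -> rational_limit Z (fun z => / qpoch (e / z) P)).
  intros e hein; apply rational_limit_inv_qpoch_div; auto.
  intros k; right; left; exists e; split; [exact hein|now exists k].
apply (rational_limit_ext Z (fun z => qpoch (n1 * z) P * qpoch (n2 * z) P *
  qtheta (h1 * z) P * qtheta (h2 * z) P * (/ qpoch (d1 * z) P * / qpoch (d2 * z) P *
  / qpoch (d3 * z) P * / qpoch (d4 * z) P * / qpoch (e1 / z) P * / qpoch (e2 / z) P))).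
  intros z _; unfold qpoch_quotient, Cdiv; now rewrite !Cinv_mult'.
repeat match goal with
  | |- rational_limit _ (fun z => @?f z * @?f' z) => apply (rational_limit_mult Z f f')
  end;
  [ now apply rational_limit_qpoch_mul | now apply rational_limit_qpoch_mul
  | now apply rational_limit_qtheta | now apply rational_limit_qtheta
  | apply hd; simpl; tauto | apply hd; simpl; tauto
  | apply hd; simpl; tauto | apply hd; simpl; tauto
  | apply he; simpl; tauto | apply he; simpl; tauto ].
Qed.

(** * The kernel and its potential *)

Lemma qpow_add (q : R) (w w' : C) : qpow q (w + w') = qpow q w * qpow q w'.
Proof.
unfold qpow.
replace (Re (w + w')) with (Re w + Re w')%R by reflexivity.
replace (Im (w + w')) with (Im w + Im w')%R by reflexivity.
rewrite Rpower_plus, RtoC_mult, Rmult_plus_distr_r, cos_plus, sin_plus.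
unfold RtoC, Cmult; simpl; f_equal; ring.
Qed.

Lemma qpow_0 (q : R) : qpow q 0 = 1.
Proof.
unfold qpow; simpl; rewrite Rmult_0_l, cos_0, sin_0.
unfold Rpower; rewrite Rmult_0_l, exp_0; unfold RtoC, Cmult; simpl; f_equal; ring.
Qed.

Lemma qpow_1 (q : R) : (0 < q)%R -> qpow q 1 = RtoC q.
Proof.
intros hq; unfold qpow; simpl; rewrite Rmult_0_l, cos_0, sin_0, Rpower_1 by exact hq.
unfold RtoC, Cmult; simpl; f_equal; ring.
Qed.

Lemma qpow_opp_mult (q : R) (w : C) : qpow q w * qpow q (- w) = 1.
Proof. rewrite <- qpow_add, <- (qpow_0 q); f_equal; ring. Qed.

Lemma qpow_neq_0 (q : R) (w : C) : qpow q w <> 0.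
Proof.
intros h; pose proof (qpow_opp_mult q w) as h1; rewrite h, Cmult_0_l in h1.
now apply C1_nz.
Qed.

Lemma qpow_opp (q : R) (w : C) : qpow q (- w) = / qpow q w.
Proof.
rewrite <- (Cmult_1_r (/ qpow q w)), <- (qpow_opp_mult q w); field; apply qpow_neq_0.
Qed.
Lemma qtheta_shift (P : R) (hP : (0 < P < 1)%R) (x : C) :
  x <> 0 -> qtheta (RtoC P * x) P = - / x * qtheta x P.
Proof.
intros hx; unfold qtheta.
assert (hP0 : RtoC P <> 0) by (apply RtoC_neq_0; lra).
replace (RtoC P / (RtoC P * x)) with (/ x) by (field; auto).
rewrite (qpoch_step P hP (/ x)), (qpoch_step P hP x).
replace (RtoC P * / x) with (RtoC P / x) by reflexivity; field; exact hx.
Qed.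

(** The coefficient A(x) without its factor 1 - a x, in terms of r = v/u and
    m = q^(2 i lambda).  That factor is kept apart because it is absorbed by the
    prefactor p(x) of the overlap coefficient:
    (1 - a x) p(q^2 x) = (1 - a/(q^2 x)) p(x). *)
Definition reduced_A (q s t r m x : C) : C :=
  / (/ q - q) * ((1 - s * q * m * x) * (1 - r * t * q * x) * (1 - r * q / t * x) /
    (q * r * s * (1 - x ^ 2) * (1 - q ^ 2 * x ^ 2))).

(** With w = u z q^(-i lambda), the recurrence divided by the value at x of prefactor
    times kernel; the terms in y are removed from both sides (they match by
    themselves), so that only rational functions of x and w remain. *)
Lemma askey_wilson_identity (q s t r m x w : C) :
  q <> 0 -> s <> 0 -> t <> 0 -> r <> 0 -> m <> 0 -> x <> 0 -> w <> 0 ->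
  1 - q ^ 2 <> 0 -> 1 - x ^ 2 <> 0 -> 1 - q ^ 2 * x ^ 2 <> 0 -> x ^ 2 - q ^ 2 <> 0 ->
  x * q ^ 2 - w <> 0 -> q ^ 2 - w * x <> 0 ->
  let a := s * q / m in
  reduced_A q s t r m x * (1 - a / (x * q ^ 2)) * (1 - w * x) / (1 - w / (x * q ^ 2)) +
  ((q * r * s + / (q * r * s)) / (/ q - q) - reduced_A q s t r m x * (1 - a * x)
    - reduced_A q s t r m (/ x) * (1 - a / x)) +
  reduced_A q s t r m (/ x) * (1 - a * x / q ^ 2) * (1 - w / x) / (1 - w * x / q ^ 2) =
  - (w / (q ^ 2 * s * t * (/ q - q))) *
    ((1 - s * m * w / q) * (1 - r * t * w / q) * (1 - a / w) * (1 - q * t / (r * w)) /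
      ((1 - w * x / q ^ 2) * (1 - w / (x * q ^ 2)))
     - q ^ 2 * (s * t / (r * m * w ^ 2)) * (1 + r ^ 2 * m ^ 2 * w ^ 2)).
Proof.
intros hq hs ht hr hm hx hw h1 h2 h3 h4 h5 h6; unfold reduced_A; cbv zeta; field.
repeat split; auto; intros h.
- apply h1; rewrite <- h; ring.
- apply h2; transitivity (- (x ^ 2 - 1)); [ring|rewrite h; ring].
- apply h3; rewrite <- h; ring.
Qed.
(** [L] and [E] stand for q^(i lambda) and q^(2 epsilon). *)
Definition kernel (q : R) (s u t v L E x y : C) : C -> C :=
  qpoch_quotient (q ^ 2) (u * s * (RtoC q * L)) (t * v * (RtoC q / L))
    (u * (E / L) / s) (v * (L / E) / t)
    (u / L * x) (u / L / x) (v * L * y) (v * L / y)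
    (s * (RtoC q / L) / u) (t * (RtoC q * L) / v).

(** The kernel times (1 - u s z L/q) (1 - t v z/(q L)) and the first factors of the
    two inner products, over the factors (1 - w x/q^2) (1 - w/(q^2 x)) that vanish at
    the additional poles of the kernels at x/q^2 and q^2 x; each factor has been
    merged into an infinite product. *)
Definition potential (q : R) (s u t v L E x y : C) : C -> C :=
  qpoch_quotient (q ^ 2) (u * s * L / RtoC q) (t * v / (RtoC q * L))
    (u * (E / L) / s) (v * (L / E) / t)
    (u / L * x / RtoC q ^ 2) (u / L / x / RtoC q ^ 2) (v * L * y) (v * L / y)
    (RtoC q ^ 2 * (s * (RtoC q / L) / u)) (RtoC q ^ 2 * (t * (RtoC q * L) / v)).

(** All infinite products are expressed through the same few ones (N1, ..., S2
    below), using (X; p) = (1 - X) (p X; p) and the quasi-periodicity of theta.  What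
    multiplies them is the identity above, together with the y-dependent part. *)
Lemma kernel_relation (q : R) (hq : (0 < q < 1)%R) (s u t v L E x y z : C) :
  s <> 0 -> u <> 0 -> t <> 0 -> v <> 0 -> L <> 0 -> E <> 0 -> x <> 0 -> y <> 0 -> z <> 0 ->
  1 - x ^ 2 <> 0 -> 1 - RtoC q ^ 2 * x ^ 2 <> 0 -> x ^ 2 - RtoC q ^ 2 <> 0 ->
  qpoch (u / L * x / RtoC q ^ 2 * z) (q ^ 2) <> 0 ->
  qpoch (u / L / x / RtoC q ^ 2 * z) (q ^ 2) <> 0 ->
  qpoch (v * L * y * z) (q ^ 2) <> 0 -> qpoch (v * L / y * z) (q ^ 2) <> 0 ->
  qpoch (s * (RtoC q / L) / u / z) (q ^ 2) <> 0 ->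
  qpoch (t * (RtoC q * L) / v / z) (q ^ 2) <> 0 ->
  let Q := RtoC q in let a := s * Q / L ^ 2 in
  let S := fun x => qpoch_pm a x (q ^ 2) in
  let A := fun x => reduced_A Q s t (v / u) (L ^ 2) x * (1 - a * x) in
  let K := fun x => kernel q s u t v L E x y z in
  let r := v / u in
  A x * (S (Q ^ 2 * x) * K (Q ^ 2 * x)) +
  ((Q * r * s + / (Q * r * s)) / (/ Q - Q) - A x - A (/ x) - (y + / y) / (/ Q - Q)) *
    (S x * K x) +
  A (/ x) * (S (x / Q ^ 2) * K (x / Q ^ 2)) =
  - (u / (Q ^ 2 * L * s * t * (/ Q - Q))) * S x *
   (z * (potential q s u t v L E x y z - Q ^ 2 * potential q s u t v L E x y (Q ^ 2 * z))).
Proof.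
intros hs hu ht hv hL hE hx hy hz h1 h2 h3 n1 n2 n3 n4 n5 n6 Q a S A K r.
fold Q in h2, h3, n1, n2, n5, n6.
assert (hP : (0 < q ^ 2 < 1)%R) by (simpl; nra).
assert (hQ : Q <> 0) by (apply RtoC_neq_0; lra).
assert (hPQ : RtoC (q ^ 2) = Q ^ 2) by apply RtoC_pow.
assert (hQ2 : 1 - Q ^ 2 <> 0).
  rewrite <- hPQ, <- RtoC_minus; apply RtoC_neq_0; lra.
assert (step : forall X, qpoch X (q ^ 2) = (1 - X) * qpoch (Q ^ 2 * X) (q ^ 2)).
  intros X; rewrite <- hPQ; now apply qpoch_step.
assert (cong : forall X Y, X = Y -> qpoch X (q ^ 2) = qpoch Y (q ^ 2)) by now intros X Y ->.
set (w := u * z / L).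
(* every infinite product will become elementary factors times one of these *)
set (N1 := qpoch (u * s * (Q * L) * z) (q ^ 2)).
set (N2 := qpoch (t * v * (Q / L) * z) (q ^ 2)).
set (T1 := qtheta (u * (E / L) / s * z) (q ^ 2)).
set (T2 := qtheta (v * (L / E) / t * z) (q ^ 2)).
set (X1 := qpoch (w * x * Q ^ 2) (q ^ 2)).
set (X2 := qpoch (w / x * Q ^ 2) (q ^ 2)).
set (Y1 := qpoch (Q ^ 2 * (v * L * y * z)) (q ^ 2)).
set (Y2 := qpoch (Q ^ 2 * (v * L / y * z)) (q ^ 2)).
set (e1 := qpoch (Q ^ 2 * (s * (Q / L) / u / z)) (q ^ 2)).
set (e2 := qpoch (Q ^ 2 * (t * (Q * L) / v / z)) (q ^ 2)).
set (S1 := qpoch (a * x * Q ^ 2) (q ^ 2)).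
set (S2 := qpoch (a / x * Q ^ 2) (q ^ 2)).
assert (hw : w <> 0) by (apply Cdiv_neq_0; [now apply Cmult_neq_0|exact hL]).
assert (qX1 : qpoch (u / L * x * z) (q ^ 2) = (1 - w * x) * X1).
  rewrite step; f_equal; [unfold w; field; auto|apply cong; unfold w; field; auto].
assert (qX2 : qpoch (u / L / x * z) (q ^ 2) = (1 - w / x) * X2).
  rewrite step; f_equal; [unfold w; field; auto|apply cong; unfold w; field; auto].
assert (qX1' : qpoch (u / L * x / Q ^ 2 * z) (q ^ 2) = (1 - w * x / Q ^ 2) * ((1 - w * x) * X1)).
  rewrite step; f_equal; [unfold w; field; auto|].
  rewrite <- qX1; apply cong; field; auto.
assert (qX2' : qpoch (u / L / x / Q ^ 2 * z) (q ^ 2) =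
    (1 - w / (x * Q ^ 2)) * ((1 - w / x) * X2)).
  rewrite step; f_equal; [unfold w; field; auto|].
  rewrite <- qX2; apply cong; field; auto.
assert (qa1 : qpoch (a * x) (q ^ 2) = (1 - a * x) * S1).
  rewrite step; f_equal; apply cong; ring.
assert (qa2 : qpoch (a / x) (q ^ 2) = (1 - a / x) * S2).
  rewrite step; f_equal; apply cong; ring.
rewrite qX1' in n1; rewrite qX2' in n2; rewrite step in n3, n4, n5, n6.
fold Y1 in n3; fold Y2 in n4; fold e1 in n5; fold e2 in n6.
assert (split2 : forall X Y : C, X * Y <> 0 -> X <> 0 /\ Y <> 0).
  intros X Y h; split; intros h0; apply h; rewrite h0; ring.
apply split2 in n1; destruct n1 as [n1 n1']; apply split2 in n1'; destruct n1' as [n1' n1''].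
apply split2 in n2; destruct n2 as [n2 n2']; apply split2 in n2'; destruct n2' as [n2' n2''].
apply split2 in n3; destruct n3 as [n3 n3'].
apply split2 in n4; destruct n4 as [n4 n4'].
apply split2 in n5; destruct n5 as [n5 n5'].
apply split2 in n6; destruct n6 as [n6 n6'].
set (C0 := N1 * N2 * T1 * T2 / (X1 * X2 * Y1 * Y2 * e1 * e2)).
set (M := (1 - v * L * y * z) * (1 - v * L / y * z) *
  (1 - s * (Q / L) / u / z) * (1 - t * (Q * L) / v / z)).
assert (hM : M <> 0) by (unfold M; repeat apply Cmult_neq_0; assumption).
assert (kx : K x = C0 / ((1 - w * x) * (1 - w / x) * M)).
  unfold K, kernel, qpoch_quotient; fold Q N1 N2 T1 T2; rewrite qX1, qX2.
  rewrite (step (v * L * y * z)), (step (v * L / y * z)), (step (s * (Q / L) / u / z)),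
    (step (t * (Q * L) / v / z)); fold Y1 Y2 e1 e2.
  unfold C0, M, Cdiv; rewrite !Cinv_mult'; ring.
assert (kup : K (Q ^ 2 * x) = C0 / ((1 - w / (x * Q ^ 2)) * (1 - w / x) * M)).
  unfold K, kernel, qpoch_quotient; fold Q N1 N2 T1 T2.
  rewrite (cong (u / L * (Q ^ 2 * x) * z) (w * x * Q ^ 2)) by (unfold w; field; auto).
  rewrite (cong (u / L / (Q ^ 2 * x) * z) (u / L / x / Q ^ 2 * z)) by (field; auto).
  rewrite qX2'; fold X1.
  rewrite (step (v * L * y * z)), (step (v * L / y * z)), (step (s * (Q / L) / u / z)),
    (step (t * (Q * L) / v / z)); fold Y1 Y2 e1 e2.
  unfold C0, M, Cdiv; rewrite !Cinv_mult'; ring.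
assert (kdown : K (x / Q ^ 2) = C0 / ((1 - w * x / Q ^ 2) * (1 - w * x) * M)).
  unfold K, kernel, qpoch_quotient; fold Q N1 N2 T1 T2.
  rewrite (cong (u / L / (x / Q ^ 2) * z) (w / x * Q ^ 2)) by (unfold w; field; auto).
  rewrite (cong (u / L * (x / Q ^ 2) * z) (u / L * x / Q ^ 2 * z)) by (field; auto).
  rewrite qX1'; fold X2.
  rewrite (step (v * L * y * z)), (step (v * L / y * z)), (step (s * (Q / L) / u / z)),
    (step (t * (Q * L) / v / z)); fold Y1 Y2 e1 e2.
  unfold C0, M, Cdiv; rewrite !Cinv_mult'; ring.
assert (gz : potential q s u t v L E x y z =
    (1 - u * s * L / Q * z) * (1 - t * v / (Q * L) * z) * C0 /
    ((1 - w * x / Q ^ 2) * (1 - w * x) * (1 - w / (x * Q ^ 2)) * (1 - w / x) *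
     (1 - v * L * y * z) * (1 - v * L / y * z))).
  unfold potential, qpoch_quotient; fold Q T1 T2; rewrite qX1', qX2'.
  rewrite (step (u * s * L / Q * z)), (step (t * v / (Q * L) * z)).
  rewrite (cong (Q ^ 2 * (u * s * L / Q * z)) (u * s * (Q * L) * z)) by (field; auto).
  rewrite (cong (Q ^ 2 * (t * v / (Q * L) * z)) (t * v * (Q / L) * z)) by (field; auto).
  rewrite (cong (Q ^ 2 * (s * (Q / L) / u) / z) (Q ^ 2 * (s * (Q / L) / u / z))) by (field; auto).
  rewrite (cong (Q ^ 2 * (t * (Q * L) / v) / z) (Q ^ 2 * (t * (Q * L) / v / z))) by (field; auto).
  rewrite (step (v * L * y * z)), (step (v * L / y * z)); fold N1 N2 Y1 Y2 e1 e2.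
  unfold C0, Cdiv; rewrite !Cinv_mult'; ring.
assert (th1 : qtheta (u * (E / L) / s * (Q ^ 2 * z)) (q ^ 2) = - / (u * (E / L) / s * z) * T1).
  unfold T1; rewrite <- qtheta_shift; [|exact hP|].
    f_equal; rewrite hPQ; ring.
  auto using Cmult_neq_0, Cdiv_neq_0.
assert (th2 : qtheta (v * (L / E) / t * (Q ^ 2 * z)) (q ^ 2) = - / (v * (L / E) / t * z) * T2).
  unfold T2; rewrite <- qtheta_shift; [|exact hP|].
    f_equal; rewrite hPQ; ring.
  auto using Cmult_neq_0, Cdiv_neq_0.
assert (gqz : potential q s u t v L E x y (Q ^ 2 * z) =
    s * t / (u * v * z ^ 2) * C0 / ((1 - w * x) * (1 - w / x) *
     (1 - s * (Q / L) / u / z) * (1 - t * (Q * L) / v / z))).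
  unfold potential, qpoch_quotient; fold Q; rewrite th1, th2.
  rewrite (cong (u * s * L / Q * (Q ^ 2 * z)) (u * s * (Q * L) * z)) by (field; auto).
  rewrite (cong (t * v / (Q * L) * (Q ^ 2 * z)) (t * v * (Q / L) * z)) by (field; auto).
  rewrite (cong (u / L * x / Q ^ 2 * (Q ^ 2 * z)) (u / L * x * z)) by (field; auto).
  rewrite (cong (u / L / x / Q ^ 2 * (Q ^ 2 * z)) (u / L / x * z)) by (field; auto).
  rewrite (cong (v * L * y * (Q ^ 2 * z)) (Q ^ 2 * (v * L * y * z))) by ring.
  rewrite (cong (v * L / y * (Q ^ 2 * z)) (Q ^ 2 * (v * L / y * z))) by ring.
  rewrite (cong (Q ^ 2 * (s * (Q / L) / u) / (Q ^ 2 * z)) (s * (Q / L) / u / z)) by (field; auto).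
  rewrite (cong (Q ^ 2 * (t * (Q * L) / v) / (Q ^ 2 * z)) (t * (Q * L) / v / z)) by (field; auto).
  rewrite qX1, qX2, (step (s * (Q / L) / u / z)), (step (t * (Q * L) / v / z)).
  fold N1 N2 Y1 Y2 e1 e2.
  replace (- / (u * (E / L) / s * z) * T1) with (- (s * L / (u * E * z)) * T1) by (field; auto).
  replace (- / (v * (L / E) / t * z) * T2) with (- (t * E / (v * L * z)) * T2) by (field; auto).
  replace (s * t / (u * v * z ^ 2)) with (s * L / (u * E * z) * (t * E / (v * L * z)))
    by (field; auto).
  unfold C0, Cdiv; rewrite !Cinv_mult'; ring.
assert (sx : S x = (1 - a * x) * (1 - a / x) * (S1 * S2)).
  unfold S, qpoch_pm; rewrite qa1, qa2; ring.
assert (sup : S (Q ^ 2 * x) = (1 - a / (x * Q ^ 2)) * (1 - a / x) * (S1 * S2)).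
  unfold S, qpoch_pm.
  rewrite (cong (a * (Q ^ 2 * x)) (a * x * Q ^ 2)) by ring.
  rewrite (cong (a / (Q ^ 2 * x)) (a / (x * Q ^ 2))) by (f_equal; ring).
  rewrite (step (a / (x * Q ^ 2))).
  rewrite (cong (Q ^ 2 * (a / (x * Q ^ 2))) (a / x)) by (unfold a; field; auto).
  rewrite qa2; fold S1; ring.
assert (sdown : S (x / Q ^ 2) = (1 - a * x / Q ^ 2) * (1 - a * x) * (S1 * S2)).
  unfold S, qpoch_pm.
  rewrite (cong (a / (x / Q ^ 2)) (a / x * Q ^ 2)) by (unfold a; field; auto).
  rewrite (cong (a * (x / Q ^ 2)) (a * x / Q ^ 2)) by (unfold Cdiv; ring).
  rewrite (step (a * x / Q ^ 2)).
  rewrite (cong (Q ^ 2 * (a * x / Q ^ 2)) (a * x)) by (unfold a; field; auto).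
  rewrite qa1; fold S2; ring.
rewrite kx, kup, kdown, gz, gqz, sx, sup, sdown.
assert (hr : r <> 0).
  now apply Cdiv_neq_0.
assert (hxw : x * Q ^ 2 - w <> 0).
  intros h; apply n2; replace (1 - w / (x * Q ^ 2)) with ((x * Q ^ 2 - w) / (x * Q ^ 2))
    by (field; auto); rewrite h; unfold Cdiv; ring.
assert (hxw' : Q ^ 2 - w * x <> 0).
  intros h; apply n1; replace (1 - w * x / Q ^ 2) with ((Q ^ 2 - w * x) / Q ^ 2)
    by (field; auto); rewrite h; unfold Cdiv; ring.
pose proof (askey_wilson_identity Q s t r (L ^ 2) x w hQ hs ht hr (Cpow_nz _ _ hL) hx hw
  hQ2 h1 h2 h3 hxw hxw') as AW; cbv zeta in AW; fold a in AW.
unfold A; fold r.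
set (R1 := reduced_A Q s t r (L ^ 2) x) in *.
set (R2 := reduced_A Q s t r (L ^ 2) (/ x)) in *.
set (B := (Q * r * s + / (Q * r * s)) / (/ Q - Q)) in *.
replace (a * / x) with (a / x) by reflexivity.
set (common := (1 - a * x) * (1 - a / x) * (S1 * S2) * C0 / ((1 - w * x) * (1 - w / x) * M)).
set (Ty := (y + / y) / (/ Q - Q)).
transitivity (common * ((R1 * (1 - a / (x * Q ^ 2)) * (1 - w * x) / (1 - w / (x * Q ^ 2)) +
  (B - R1 * (1 - a * x) - R2 * (1 - a / x)) +
  R2 * (1 - a * x / Q ^ 2) * (1 - w / x) / (1 - w * x / Q ^ 2)) - Ty)).
{ unfold common; clearbody M C0 Ty R1 R2 B S1 S2.
  revert n1 n1' n2 n2'.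
  generalize (1 - w * x / Q ^ 2) (1 - w * x) (1 - w / (x * Q ^ 2)) (1 - w / x)
    (1 - a / x) (1 - a * x) (1 - a / (x * Q ^ 2)) (1 - a * x / Q ^ 2).
  intros; field; auto. }
rewrite AW; unfold common, M.
set (k0 := w / (Q ^ 2 * s * t * (/ Q - Q))).
set (k := s * t / (r * L ^ 2 * w ^ 2)).
replace (- (u / (Q ^ 2 * L * s * t * (/ Q - Q))) * ((1 - a * x) * (1 - a / x) * (S1 * S2)))
  with (- (k0 / z) * ((1 - a * x) * (1 - a / x) * (S1 * S2))).
2: { unfold k0, w; field; repeat split; auto; intros h; apply hQ2; rewrite <- h; ring. }
replace (s * t / (u * v * z ^ 2)) with k by (unfold k, r, w; field; auto).
replace (1 - s * L ^ 2 * w / Q) with (1 - u * s * L / Q * z) by (unfold w; field; auto).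
replace (1 - r * t * w / Q) with (1 - t * v / (Q * L) * z) by (unfold r, w; field; auto).
replace (1 - a / w) with (1 - s * (Q / L) / u / z) by (unfold a, w; field; auto).
replace (1 - Q * t / (r * w)) with (1 - t * (Q * L) / v / z) by (unfold r, w; field; auto).
(* the y-dependent part of the eigenvalue comes from the last term alone *)
replace Ty with (k0 * Q ^ 2 * k * (1 + r ^ 2 * (L ^ 2) ^ 2 * w ^ 2 -
  (1 - v * L * y * z) * (1 - v * L / y * z))).
2: { unfold Ty, k0, k, r, w; field; repeat split; auto; intros h; apply hQ2;
     rewrite <- h; ring. }
clearbody k0 k C0 S1 S2.
revert n1 n1' n2 n2' n3 n4 n5 n6.
generalize (1 - w * x / Q ^ 2) (1 - w * x) (1 - w / (x * Q ^ 2)) (1 - w / x)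
  (1 - v * L * y * z) (1 - v * L / y * z) (1 - s * (Q / L) / u / z)
  (1 - t * (Q * L) / v / z) (1 - a * x) (1 - a / x).
intros; field; repeat split; auto.
Qed.
(** * The recurrences *)

Definition inner_poles (q : R) (s u t v L : C) : list C :=
  s * (RtoC q / L) / u :: t * (RtoC q * L) / v :: nil.

Definition outer_poles (u v L x y : C) : list C :=
  / (u / L * x) :: / (u / L / x) :: / (v * L * y) :: / (v * L / y) :: nil.

Lemma overlap_kernelE (q : R) (s u t v : C) (lam eps : R) (x y z : C) :
  (0 < q)%R ->
  overlap_kernel q (Params s u t v lam eps) x y z =
  kernel q s u t v (qpow q (Ci * lam)) (qpow q (2 * RtoC eps)) x y z.
Proof.
intros hq; unfold overlap_kernel, kernel, qpoch_quotient, qpoch_pm; simpl ps; simpl pu; simpl pt;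
  simpl pv; simpl plam; simpl peps.
set (L := qpow q (Ci * lam)); set (E := qpow q (2 * RtoC eps)).
assert (h1 : qpow q (1 - Ci * lam) = RtoC q / L).
  unfold Cminus; now rewrite qpow_add, qpow_1, qpow_opp.
assert (h2 : qpow q (1 + Ci * lam) = RtoC q * L) by now rewrite qpow_add, qpow_1.
assert (h3 : qpow q (2 * RtoC eps - Ci * lam) = E / L).
  unfold Cminus; now rewrite qpow_add, qpow_opp.
assert (h4 : qpow q (- 2 * RtoC eps + Ci * lam) = L / E).
  replace (- 2 * RtoC eps + Ci * lam) with (Ci * lam + - (2 * RtoC eps)) by ring.
  now rewrite qpow_add, qpow_opp.
rewrite h1, h2, h3, h4, qpow_opp; fold L.
replace (u * s * (RtoC q * L) * z) with (u * s * z * (RtoC q * L)) by ring.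
replace (t * v * (RtoC q / L) * z) with (t * v * z * (RtoC q / L)) by ring.
replace (u * (E / L) / s * z) with (u * z * (E / L) / s) by (unfold Cdiv; ring).
replace (v * (L / E) / t * z) with (v * z * (L / E) / t) by (unfold Cdiv; ring).
replace (u / L * x * z) with (u * z * / L * x) by (unfold Cdiv; ring).
replace (u / L / x * z) with (u * z * / L / x) by (unfold Cdiv; ring).
replace (v * L * y * z) with (v * z * L * y) by ring.
replace (v * L / y * z) with (v * z * L / y) by (unfold Cdiv; ring).
replace (s * (RtoC q / L) / u / z) with (s * (RtoC q / L) / (u * z))
  by (unfold Cdiv; rewrite !Cinv_mult'; ring).
replace (t * (RtoC q * L) / v / z) with (t * (RtoC q * L) / (v * z))
  by (unfold Cdiv; rewrite !Cinv_mult'; ring).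
apply (f_equal2 Cdiv); ring.
Qed.

Lemma admissible_encloses (q : R) (s u t v : C) (lam eps : R) (x y : C) (g : list path) :
  (0 < q)%R -> u <> 0 -> v <> 0 -> x <> 0 -> y <> 0 ->
  admissible q (Params s u t v lam eps) x y g ->
  encloses (q ^ 2) (inner_poles q s u t v (qpow q (Ci * lam)))
    (outer_poles u v (qpow q (Ci * lam)) x y) g.
Proof.
intros hq hu hv hx hy (hg & h0 & h); simpl in h0, h.
set (L := qpow q (Ci * lam)) in *.
assert (hL : L <> 0) by apply qpow_neq_0.
assert (h1 : qpow q (1 - Ci * lam) = RtoC q / L).
  unfold Cminus; now rewrite qpow_add, qpow_1, qpow_opp.
assert (h2 : qpow q (1 + Ci * lam) = RtoC q * L) by now rewrite qpow_add, qpow_1.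
rewrite h1, h2, qpow_opp in h; fold L in h.
split; [now apply closed_curve_cycle|split; [exact h0|split]].
- intros i hi k; destruct (h k) as (a1 & a2 & _).
  destruct hi as [<-|[<-|[]]].
    replace (s * (RtoC q / L) / u) with (s / u * (RtoC q / L)) by (unfold Cdiv; ring).
    exact a1.
  replace (t * (RtoC q * L) / v) with (t / v * (RtoC q * L)) by (unfold Cdiv; ring).
  exact a2.
- intros o ho m; destruct (h m) as (_ & _ & a1 & a2 & a3 & a4).
  destruct ho as [<-|[<-|[<-|[<-|[]]]]].
  + replace (/ (u / L * x)) with (/ u * L / x) by (field; auto); exact a2.
  + replace (/ (u / L / x)) with (/ u * L * x) by (field; auto); exact a1.
  + replace (/ (v * L * y)) with (/ v * / L / y) by (field; auto); exact a4.
  + replace (/ (v * L / y)) with (/ v * / L * y) by (field; auto); exact a3.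
Qed.

(** Any cycle with the right winding numbers may replace the contour on which the
    value is given. *)
Lemma is_overlap_on (q : R) (hq : (0 < q < 1)%R) (s u t v : C) (lam eps : R)
    (x y w : C) (g : list path) :
  u <> 0 -> v <> 0 -> x <> 0 -> y <> 0 ->
  let L := qpow q (Ci * lam) in let E := qpow q (2 * RtoC eps) in
  is_overlap q (Params s u t v lam eps) x y w ->
  encloses (q ^ 2) (inner_poles q s u t v L) (outer_poles u v L x y) g ->
  exists I : C, is_cint (fun z => kernel q s u t v L E x y z * / z) g I /\
    w = overlap_prefactor q (Params s u t v lam eps) x y * (/ (2 * PI * Ci) * I).
Proof.
intros hu hv hx hy L E (g0 & hadm & ->) hg.
assert (hL : L <> 0) by apply qpow_neq_0.
assert (hP : (0 < q ^ 2 < 1)%R) by (simpl; nra).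
apply admissible_encloses in hadm; auto; [|lra].
destruct (encloses_same_integral _ _ _ _ _ (fun z => kernel q s u t v L E x y z * / z) hadm hg)
  as (I & h1 & h2).
  apply (rational_limit_mult _ (kernel q s u t v L E x y) (fun z => / z));
    [|apply rational_limit_inv_id; now left].
  unfold kernel, inner_poles, outer_poles.
  apply (rational_limit_qpoch_quotient (q ^ 2) hP); auto using Cmult_neq_0, Cdiv_neq_0.
exists I; split; [exact h2|].
do 2 f_equal; apply is_cint_unique.
refine (is_cint_ext _ _ _ _ _ h1); intros p _ r _; cbv beta.
now rewrite overlap_kernelE by lra.
Qed.

Lemma coef_AE (q : R) (hq : (0 < q < 1)%R) (s u t v : C) (lam eps : R) (x : C) :
  s <> 0 -> u <> 0 -> t <> 0 -> v <> 0 ->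
  let L := qpow q (Ci * lam) in
  coef_A q (Params s u t v lam eps) x =
  reduced_A (RtoC q) s t (v / u) (L ^ 2) x * (1 - s * RtoC q / L ^ 2 * x).
Proof.
intros hs hu ht hv L.
assert (hL : L <> 0) by apply qpow_neq_0.
assert (hQ : RtoC q <> 0) by (apply RtoC_neq_0; lra).
unfold coef_A, coef_dt, reduced_A; simpl ps; simpl pu; simpl pt; simpl pv; simpl plam.
replace (1 - 2 * (Ci * lam)) with (1 + - (Ci * lam + Ci * lam)) by ring.
replace (1 + 2 * (Ci * lam)) with (1 + (Ci * lam + Ci * lam)) by ring.
rewrite !qpow_add, qpow_opp, !qpow_add, qpow_1 by lra; fold L.
rewrite RtoC_minus, RtoC_inv, RtoC_pow by lra.
replace (RtoC q ^ 2 / (u * RtoC q / (v * s))) with (RtoC q * (v / u) * s)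
  by (field; auto).
replace (s * (RtoC q * / (L * L))) with (s * RtoC q / L ^ 2) by (field; auto).
replace (s * (RtoC q * (L * L))) with (s * RtoC q * L ^ 2) by ring.
replace (v * t * RtoC q / u) with (v / u * t * RtoC q) by (unfold Cdiv; ring).
replace (v * RtoC q / (u * t)) with (v / u * RtoC q / t) by (field; auto).
unfold Cdiv; ring.
Qed.

(** A common point would have winding number both 1 and 0. *)
Lemma encloses_disjoint (P : R) (ins outs : list C) (g : list path) (i o : C) (k m : nat) :
  encloses P ins outs g -> In i ins -> In o outs -> i * RtoC P ^ k <> o / RtoC P ^ m.
Proof.
intros (_ & _ & hi & ho) hii hoo h.
pose proof (proj2 (hi i hii k)) as h1; rewrite h in h1.
rewrite (proj2 (ho o hoo m)) in h1; exact (C1_nz (eq_sym h1)).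
Qed.

Lemma recurrence_in_x (q : R) (hq : (0 < q < 1)%R) (s u t v : C) (lam eps : R)
    (x y : C) (hs : s <> 0) (hu : u <> 0) (ht : t <> 0) (hv : v <> 0)
    (hx : x <> 0) (hy : y <> 0) :
  let al := Params s u t v lam eps in
  let q2 := RtoC (q ^ 2) in
  coef_A_defined q x -> coef_A_defined q (/ x) ->
  forall Phi Phi_up Phi_down : C,
    is_overlap q al x y Phi ->
    is_overlap q al (q2 * x) y Phi_up ->
    is_overlap q al (x / q2) y Phi_down ->
    (mu q y - mu q t) * Phi =
    coef_A q al x * Phi_up + coef_B q al x * Phi + coef_A q al (/ x) * Phi_down.
Proof.
intros al q2 [d1 d2] [d3 d4] Phi Phi_up Phi_down hPhi hup hdown.
set (L := qpow q (Ci * lam)); set (E := qpow q (2 * RtoC eps)).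
assert (hL : L <> 0) by apply qpow_neq_0.
assert (hE : E <> 0) by apply qpow_neq_0.
assert (hP : (0 < q ^ 2 < 1)%R) by (simpl; nra).
assert (hQ : RtoC q <> 0) by (apply RtoC_neq_0; lra).
assert (hq2 : q2 <> 0) by (apply RtoC_neq_0; lra).
assert (hqq : q2 = RtoC q ^ 2) by apply RtoC_pow.
set (ins := inner_poles q s u t v L).
set (outs := L / u * (q2 * x) :: L / u * (q2 / x) :: / (v * L * y) :: / (v * L / y) :: nil).
assert (hq2x : q2 * x <> 0) by now apply Cmult_neq_0.
assert (hxq2 : x / q2 <> 0) by now apply Cdiv_neq_0.
assert (hpow : forall z : C, z = z / RtoC (q ^ 2) ^ 0) by (intros z; simpl; field; exact C1_nz).
(* the first two outer progressions are taken long enough for x, q^2 x and x/q^2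
   simultaneously; their first points, which do not come with x, are outer points
   for q^2 x and for x/q^2 respectively *)
assert (hG : exists g, encloses (q ^ 2) ins outs g).
{ apply contour_exists; [exact hP| |].
    intros o [<-|[<-|[<-|[<-|[]]]]]; auto using Cmult_neq_0, Cdiv_neq_0, Cinv_neq_0.
  intros i o hi ho k m.
  destruct hPhi as (g1 & a1 & _), hup as (g2 & a2 & _), hdown as (g3 & a3 & _).
  apply admissible_encloses in a1, a2, a3; auto; try lra.
  fold L ins in a1, a2, a3.
  destruct ho as [<-|[<-|[<-|[<-|[]]]]].
  - apply (encloses_disjoint _ _ _ _ _ _ k m a2 hi); right; left; field; auto.
  - apply (encloses_disjoint _ _ _ _ _ _ k m a3 hi); left; field; auto.
  - apply (encloses_disjoint _ _ _ _ _ _ k m a1 hi); simpl; tauto.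
  - apply (encloses_disjoint _ _ _ _ _ _ k m a1 hi); simpl; tauto. }
destruct hG as [G hG].
assert (hsub : forall X, In X (x :: q2 * x :: x / q2 :: nil) ->
    encloses (q ^ 2) ins (outer_poles u v L X y) G).
{ intros X hX; apply (encloses_sub _ _ _ _ _ _ (proj1 hP) hG).
    intros i hi; exists i, O; split; [exact hi|simpl; ring].
  assert (hend : forall o', In o' (/ (v * L * y) :: / (v * L / y) :: nil) ->
      exists o j, In o outs /\ o' = o / RtoC (q ^ 2) ^ j).
    intros o' ho'; exists o', O; split; [simpl in *; tauto|apply hpow].
  fold q2; destruct hX as [<-|[<-|[<-|[]]]];
    intros o' [<-|[<-|ho']]; try (now apply hend).
  - exists (L / u * (q2 / x)), 1%nat; split; [simpl; tauto|simpl; field; auto].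
  - exists (L / u * (q2 * x)), 1%nat; split; [simpl; tauto|simpl; field; auto].
  - exists (L / u * (q2 / x)), 2%nat; split; [simpl; tauto|simpl; field; auto].
  - exists (L / u * (q2 * x)), 0%nat; split; [simpl; tauto|simpl; field; auto].
  - exists (L / u * (q2 / x)), 0%nat; split; [simpl; tauto|simpl; field; auto].
  - exists (L / u * (q2 * x)), 2%nat; split; [simpl; tauto|simpl; field; auto]. }
destruct (is_overlap_on q hq s u t v lam eps x y Phi G hu hv hx hy hPhi) as (I1 & i1 & e1).
  apply hsub; simpl; tauto.
destruct (is_overlap_on q hq s u t v lam eps (q2 * x) y Phi_up G hu hv hq2x hy hup)
  as (I2 & i2 & e2).
  apply hsub; simpl; tauto.
destruct (is_overlap_on q hq s u t v lam eps (x / q2) y Phi_down G hu hv hxq2 hy hdown)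
  as (I3 & i3 & e3).
  apply hsub; simpl; tauto.
fold L E in i1, i2, i3.
(* the potential has the inner progressions from their second point on only, which
   is why the dilated contour encloses the same poles *)
assert (hpot : same_integral G (map (dilate q2) G) (potential q s u t v L E x y)).
{ set (ins' := q2 * (s * (RtoC q / L) / u) :: q2 * (t * (RtoC q * L) / v) :: nil).
  set (outs' := / (u / L * x / q2) :: / (u / L / x / q2) :: / (v * L * y) ::
    / (v * L / y) :: nil).
  apply (encloses_same_integral (q ^ 2) ins' outs').
  - apply (encloses_sub _ _ _ _ _ _ (proj1 hP) hG).
      intros i [<-|[<-|[]]].
        exists (s * (RtoC q / L) / u), 1%nat; split; [simpl; tauto|unfold q2; simpl; ring].
      exists (t * (RtoC q * L) / v), 1%nat; split; [simpl; tauto|unfold q2; simpl; ring].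
    intros o [<-|[<-|ho]].
    + exists (L / u * (q2 / x)), 0%nat; split; [simpl; tauto|simpl; field; auto].
    + exists (L / u * (q2 * x)), 0%nat; split; [simpl; tauto|simpl; field; auto].
    + exists o, O; split; [simpl in *; tauto|apply hpow].
  - apply (encloses_sub _ _ _ _ _ _ (proj1 hP) (encloses_dilate _ q2 _ _ _ (proj1 hP) hq2 hG)).
      intros i hi; exists i, O; split; [exact hi|simpl; ring].
    assert (hend : forall o, In o outs ->
        exists o1 j, In o1 (map (Cmult q2) outs) /\ o = o1 / RtoC (q ^ 2) ^ j).
      intros o ho; exists (q2 * o), 1%nat; split; [now apply in_map|].
      fold q2; simpl; field; auto.
    intros o [<-|[<-|ho]].
    + replace (/ (u / L * x / q2)) with (L / u * (q2 / x)) by (field; auto).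
      apply hend; simpl; tauto.
    + replace (/ (u / L / x / q2)) with (L / u * (q2 * x)) by (field; auto).
      apply hend; simpl; tauto.
    + apply hend; simpl in *; tauto.
  - unfold ins', outs', potential; rewrite hqq.
    apply (rational_limit_qpoch_quotient (q ^ 2) hP); rewrite <- ?hqq;
      auto using Cmult_neq_0, Cdiv_neq_0. }
destruct hpot as (J & j1 & j2); apply is_cint_dilate in j2.
set (a := s * RtoC q / L ^ 2).
set (T := qpoch_pm (t * qpow q (1 + 2 * (Ci * lam))) y (q ^ 2)).
set (S := fun X => qpoch_pm a X (q ^ 2)).
assert (hpre : forall X, overlap_prefactor q al X y = S X * T).
{ intros X; unfold overlap_prefactor, al; simpl ps; simpl pt; simpl plam; fold T.
  unfold S; do 2 f_equal.
  replace (1 - 2 * (Ci * lam)) with (1 + - (Ci * lam + Ci * lam)) by ring.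
  rewrite qpow_add, qpow_opp, qpow_add, qpow_1 by lra; fold L.
  unfold a; field; auto. }
unfold al in e1, e2, e3; fold al in e1, e2, e3; rewrite hpre in e1, e2, e3.
set (A := fun X => coef_A q al X).
set (kap := - (u / (RtoC q ^ 2 * L * s * t * (/ RtoC q - RtoC q))) * S x).
set (Bm := (RtoC q * (v / u) * s + / (RtoC q * (v / u) * s)) / (/ RtoC q - RtoC q)
  - A x - A (/ x) - mu q y).
assert (hBm : coef_B q al x - (mu q y - mu q t) = Bm).
{ unfold coef_B, Bm, A, coef_dt, al; simpl ps; simpl pu; simpl pt; simpl pv.
  rewrite RtoC_minus, RtoC_inv, RtoC_pow by lra.
  replace (RtoC q ^ 2 / (u * RtoC q / (v * s))) with (RtoC q * (v / u) * s)
    by (field; auto).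
  replace (u * RtoC q / (v * s) / RtoC q ^ 2) with (/ (RtoC q * (v / u) * s))
    by (field; auto).
  ring. }
assert (hpoint : forall z, ~ poles (q ^ 2) ins outs z ->
  kap * (potential q s u t v L E x y z + - (1) * (q2 * potential q s u t v L E x y (q2 * z))) =
  A x * S (q2 * x) * (kernel q s u t v L E (q2 * x) y z * / z) +
    (Bm * S x * (kernel q s u t v L E x y z * / z) +
     A (/ x) * S (x / q2) * (kernel q s u t v L E (x / q2) y z * / z))).
{ intros z hz.
  assert (hz0 : z <> 0) by (intros ->; apply hz; now left).
  assert (hin : forall i, In i ins -> qpoch (i / z) (q ^ 2) <> 0).
  { intros i hi; apply qpoch_neq_0; [exact hP|]; intros k; apply qpoch_div_factor; auto.
    intros ->; apply hz; right; left; exists i; split; [exact hi|now exists k]. }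
  assert (hout : forall c : C, c <> 0 -> In (/ c) outs -> qpoch (c * z) (q ^ 2) <> 0).
  { intros c hc ho; apply qpoch_neq_0; [exact hP|]; intros k.
    apply (qpoch_mul_factor _ (proj1 hP) _ _ _ hc).
    intros ->; apply hz; right; right; exists (/ c); split; [exact ho|now exists k]. }
  assert (h4 : x ^ 2 - RtoC q ^ 2 <> 0).
  { rewrite <- hqq; intros h; apply d4; fold q2.
    replace (1 - q2 * (/ x) ^ 2) with ((x ^ 2 - q2) / x ^ 2) by (field; auto).
    rewrite h; unfold Cdiv; ring. }
  unfold q2 in d2; rewrite RtoC_pow in d2.
  assert (hA : forall X, A X = reduced_A (RtoC q) s t (v / u) (L ^ 2) X * (1 - a * X))
    by (intros X; unfold A, al; now rewrite coef_AE).
  set (k1 := kernel q s u t v L E x y z).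
  set (k2 := kernel q s u t v L E (q2 * x) y z).
  set (k3 := kernel q s u t v L E (x / q2) y z).
  set (g1 := potential q s u t v L E x y z).
  set (g2 := potential q s u t v L E x y (q2 * z)).
  assert (hr : A x * (S (q2 * x) * k2) + Bm * (S x * k1) + A (/ x) * (S (x / q2) * k3) =
    kap * (z * (g1 - q2 * g2))).
  { unfold Bm, k1, k2, k3, g1, g2, mu; rewrite !hA, RtoC_minus, RtoC_inv, hqq by lra.
    apply (kernel_relation q hq s u t v L E x y z hs hu ht hv hL hE hx hy hz0 d1 d2 h4);
      rewrite <- ?hqq.
    - apply hout; [auto using Cdiv_neq_0, Cmult_neq_0|].
      replace (/ (u / L * x / q2)) with (L / u * (q2 / x)) by (field; auto); simpl; tauto.
    - apply hout; [auto using Cdiv_neq_0, Cmult_neq_0|].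
      replace (/ (u / L / x / q2)) with (L / u * (q2 * x)) by (field; auto); simpl; tauto.
    - apply hout; [auto using Cdiv_neq_0, Cmult_neq_0|simpl; tauto].
    - apply hout; [auto using Cdiv_neq_0, Cmult_neq_0|simpl; tauto].
    - apply hin; simpl; tauto.
    - apply hin; simpl; tauto. }
  clearbody kap Bm A S k1 k2 k3 g1 g2.
  transitivity (/ z * (kap * (z * (g1 - q2 * g2)))); [field; exact hz0|].
  rewrite <- hr; ring. }
assert (hL1 : is_cint (fun z => A x * S (q2 * x) * (kernel q s u t v L E (q2 * x) y z * / z) +
    (Bm * S x * (kernel q s u t v L E x y z * / z) +
     A (/ x) * S (x / q2) * (kernel q s u t v L E (x / q2) y z * / z))) G
  (A x * S (q2 * x) * I2 + (Bm * S x * I1 + A (/ x) * S (x / q2) * I3))).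
{ apply is_cint_plus; [now apply is_cint_scal|].
  apply is_cint_plus; now apply is_cint_scal. }
assert (hR1 : is_cint (fun z => kap * (potential q s u t v L E x y z +
    - (1) * (q2 * potential q s u t v L E x y (q2 * z)))) G (kap * (J + - (1) * J))).
{ apply is_cint_scal, is_cint_plus; [exact j1|now apply is_cint_scal]. }
assert (h0 : A x * S (q2 * x) * I2 + (Bm * S x * I1 + A (/ x) * S (x / q2) * I3) = 0).
{ transitivity (kap * (J + - (1) * J)); [|ring].
  rewrite <- (is_cint_unique _ _ _ hL1); apply is_cint_unique.
  refine (is_cint_ext _ _ _ _ _ hR1); intros p hp r hr; cbv beta.
  apply hpoint; intros hz; exact (encloses_avoids _ _ _ _ hG _ hz p hp r hr eq_refl). }
transitivity ((A x * Phi_up + coef_B q al x * Phi + A (/ x) * Phi_down) -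
  T * / (2 * PI * Ci) *
  (A x * S (q2 * x) * I2 + (Bm * S x * I1 + A (/ x) * S (x / q2) * I3))).
  rewrite e1, e2, e3, <- hBm; ring.
rewrite h0; unfold A; ring.
Qed.
Lemma overlap_kernel_swap (q : R) (s u t v : C) (lam eps : R) (x y z : C) :
  overlap_kernel q (Params t v s u (- lam) (- eps)) y x z =
  overlap_kernel q (Params s u t v lam eps) x y z.
Proof.
unfold overlap_kernel, qpoch_pm; simpl ps; simpl pu; simpl pt; simpl pv; simpl plam;
  simpl peps; rewrite !RtoC_opp.
replace (1 + Ci * - lam) with (1 - Ci * lam) by ring.
replace (1 - Ci * - lam) with (1 + Ci * lam) by ring.
replace (2 * - eps - Ci * - lam) with (- 2 * eps + Ci * lam) by ring.
replace (- 2 * - eps + Ci * - lam) with (2 * eps - Ci * lam) by ring.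
replace (- (Ci * - lam)) with (Ci * lam) by ring.
replace (Ci * - lam) with (- (Ci * lam)) by ring.
replace (v * t * z) with (t * v * z) by ring.
replace (s * u * z) with (u * s * z) by ring.
apply (f_equal2 Cdiv); ring.
Qed.

Lemma overlap_prefactor_swap (q : R) (s u t v : C) (lam eps : R) (x y : C) :
  overlap_prefactor q (Params t v s u (- lam) (- eps)) y x =
  overlap_prefactor q (Params s u t v lam eps) x y.
Proof.
unfold overlap_prefactor; simpl ps; simpl pt; simpl plam; rewrite !RtoC_opp.
replace (1 - 2 * (Ci * - lam)) with (1 + 2 * (Ci * lam)) by ring.
replace (1 + 2 * (Ci * - lam)) with (1 - 2 * (Ci * lam)) by ring.
ring.
Qed.

(** The integrand is symmetric under the exchange of (s, u, x) with (t, v, y)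
    together with lambda -> -lambda, epsilon -> -epsilon. *)
Lemma is_overlap_swap (q : R) (s u t v : C) (lam eps : R) (x y w : C) :
  is_overlap q (Params s u t v lam eps) x y w ->
  is_overlap q (Params t v s u (- lam) (- eps)) y x w.
Proof.
intros (g & (hg & h0 & h) & ->); exists g; split.
- split; [exact hg|split; [exact h0|]]; intros k; specialize (h k).
  simpl in h |- *; rewrite !RtoC_opp.
  replace (1 + Ci * - lam) with (1 - Ci * lam) by ring.
  replace (1 - Ci * - lam) with (1 + Ci * lam) by ring.
  replace (- (Ci * - lam)) with (Ci * lam) by ring.
  replace (Ci * - lam) with (- (Ci * lam)) by ring.
  tauto.
- rewrite overlap_prefactor_swap; do 2 f_equal.
  unfold contour_integral; f_equal; apply map_ext; intros p.
  unfold path_integral; apply (RInt_ext (V := C_R_CompleteNormedModule)); intros r _.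
  now rewrite overlap_kernel_swap.
Qed.

(** Changing the sign of lambda exchanges the parameters a and b. *)
Lemma coef_A_opp_lam (q : R) (s u t v : C) (lam eps eps' : R) (x : C) :
  coef_A q (Params s u t v (- lam) eps) x = coef_A q (Params s u t v lam eps') x.
Proof.
unfold coef_A, coef_dt; simpl ps; simpl pu; simpl pt; simpl pv; simpl plam.
rewrite RtoC_opp.
replace (1 - 2 * (Ci * - lam)) with (1 + 2 * (Ci * lam)) by ring.
replace (1 + 2 * (Ci * - lam)) with (1 - 2 * (Ci * lam)) by ring.
unfold Cdiv; ring.
Qed.

Theorem theorem3p9 (q : R) (hq : (0 < q < 1)%R) (s u t v : C) (lam eps : R)
    (x y : C) (hs : s <> 0) (hu : u <> 0) (ht : t <> 0) (hv : v <> 0)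
    (hx : x <> 0) (hy : y <> 0) :
  let al := Params s u t v lam eps in
  let al' := vartheta al in
  let q2 := RtoC (q ^ 2) in
  (coef_A_defined q x -> coef_A_defined q (/ x) ->
   forall Phi Phi_up Phi_down : C,
     is_overlap q al x y Phi ->
     is_overlap q al (q2 * x) y Phi_up ->
     is_overlap q al (x / q2) y Phi_down ->
     (mu q y - mu q t) * Phi =
     coef_A q al x * Phi_up + coef_B q al x * Phi + coef_A q al (/ x) * Phi_down)
  /\
  (coef_A_defined q y -> coef_A_defined q (/ y) ->
   forall Phi Phi_up Phi_down : C,
     is_overlap q al x y Phi ->
     is_overlap q al x (q2 * y) Phi_up ->
     is_overlap q al x (y / q2) Phi_down ->
     (mu q x - mu q s) * Phi =
     coef_A q al' y * Phi_up + coef_B q al' y * Phi + coef_A q al' (/ y) * Phi_down).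
Proof.
split; [now apply recurrence_in_x|].
intros h1 h2 Phi Phi_up Phi_down hPhi hup hdown.
apply is_overlap_swap in hPhi, hup, hdown.
rewrite (recurrence_in_x q hq t v s u (- lam) (- eps) y x ht hv hs hu hy hx h1 h2 _ _ _
  hPhi hup hdown).
unfold coef_B, vartheta; simpl.
now rewrite !(coef_A_opp_lam q t v s u lam (- eps) (- eps)).
Qed.
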